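(* Let $\mathcal{A}$ be a small abelian category and let $\mathcal{C}\subseteq\mathcal{A}$ be a full additive, strictly full, Karoubi closed subcategory which is $\mathcal{A}$-approximating. Assume that $\mathcal{A}$ is Krull-Schmidt and that $\mathcal{H}_{\mathcal{A}}$ has enough simples. Then $\mathcal{H}_{\mathcal{C}}$ has enough simples, and each indecomposable projective $\mathsf{P}_Z$ of $\mathcal{H}_{\mathcal{C}}$ ($Z\in\mathcal{C}$ indecomposable) has a unique simple quotient $\mathsf{L}_Z$. For $Z\in\mathcal{A}$ indecomposable, let $\mathsf{L}^{\mathcal{A}}_Z$ denote the simple quotient of $\mathsf{P}_Z$ in $\mathcal{H}_{\mathcal{A}}$; then $\pi_{\mathcal{C}}(\mathsf{L}^{\mathcal{A}}_Z)=\mathsf{L}_Z$ if $Z\in\mathcal{C}$, and $\pi_{\mathcal{C}}(\mathsf{L}^{\mathcal{A}}_Z)=0$ otherwise. Moreover, any simple object of $\mathcal{H}_{\mathcal{C}}$ is isomorphic to some $\mathsf{L}_M$.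
   Context: Strictly full means closed under isomorphisms; Karoubi closed means closed under direct summands in $\mathcal{A}$. An abelian category has enough simples if each indecomposable projective has a simple quotient. Simple quotients are considered up to isomorphism. $\mathcal{T}_{\mathcal{C}}=K^-(\mathcal{C})$ (bounded above cochain complexes modulo homotopy) is a full triangulated subcategory of $\mathcal{T}_{\mathcal{A}}=K^-(\mathcal{A})$. $\mathcal{H}_{\mathcal{A}}$ is the abelian category of complexes $[X^{-2}\to X^{-1}\to X^0]$ in $\mathcal{A}$ (degrees $-2,-1,0$) with no cohomology in negative degrees, morphisms being morphisms of complexes modulo homotopy; it is the heart of the $t$-structure on $\mathcal{T}_{\mathcal{A}}$ whose $\leq 0$ part is generated by complexes $X$ with $X^i=0$ for $i>0$. A $\mathcal{C}$-approximation of $X\in\mathcal{T}_{\mathcal{A}}$ is a quasi-isomorphism $X_{\mathcal{C}}\to X$ with $X_{\mathcal{C}}\in\mathcal{T}_{\mathcal{C}}$ inducing an isomorphism $\mathrm{Hom}_{\mathcal{T}_{\mathcal{C}}}(-,X_{\mathcal{C}})\to\mathrm{Hom}_{\mathcal{T}_{\mathcal{A}}}(-,X)|_{\mathcal{T}_{\mathcal{C}}}$. $\mathcal{C}$ is $\mathcal{A}$-approximating if every $X\in\mathcal{T}_{\mathcal{A}}$ has a $\mathcal{C}$-approximation; then $\pi_{\mathcal{C}}X=X_{\mathcal{C}}$ defines a functor $\pi_{\mathcal{C}}:\mathcal{T}_{\mathcal{A}}\to\mathcal{T}_{\mathcal{C}}$ right adjoint to the inclusion, and it maps $\mathcal{H}_{\mathcal{A}}$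 into $\mathcal{H}_{\mathcal{C}}$. $\mathcal{T}^{\leq 0}_{\mathcal{C}}$ is the strictly full subcategory of $\mathcal{T}_{\mathcal{C}}$ generated by complexes $X$ with $X^i=0$ for $i>0$; it is the $\leq 0$ part of a $t$-structure with $\mathcal{T}^{\geq 0}_{\mathcal{C}}=\{X\in\mathcal{T}_{\mathcal{C}}\mid\mathrm{Hom}(\mathcal{T}^{\leq 0}_{\mathcal{C}}[1],X)=0\}$; $\mathcal{H}_{\mathcal{C}}=\mathcal{T}^{\leq 0}_{\mathcal{C}}\cap\mathcal{T}^{\geq 0}_{\mathcal{C}}$ is its heart. $\mathsf{P}_M$ is the complex with $M$ concentrated in degree $0$; $M\mapsto\mathsf{P}_M$ gives equivalences $\mathcal{A}\cong\mathrm{Proj}(\mathcal{H}_{\mathcal{A}})$ and $\mathcal{C}\cong\mathrm{Proj}(\mathcal{H}_{\mathcal{C}})$. *)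

(* Defs.v *)
From HB Require Import structures.
From mathcomp Require Import all_boot all_order all_algebra.
From mathcomp Require Import ring_quotient.
From mathcomp Require Import boolp.

Set Implicit Arguments.
Unset Strict Implicit.
Unset Printing Implicit Defensive.

Import Order.TTheory GRing.Theory Num.Theory.
Local Open Scope ring_scope.
Local Open Scope quotient_scope.

Record preadditive := Preadditive {
  obj :> Type;
  hom : obj -> obj -> zmodType;
  idm : forall X, hom X X;
  comp : forall X Y Z, hom Y Z -> hom X Y -> hom X Z;
  compA : forall W X Y Z (h : hom Y Z) (g : hom X Y) (f : hom W X),
    comp h (comp g f) = comp (comp h g) f;
  comp1m : forall X Y (f : hom X Y), comp (idm Y) f = f;
  compm1 : forall X Y (f : hom X Y), comp f (idm X) = f;
  compDl : forall X Y Z (g g' : hom Y Z) (f : hom X Y),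
    comp (g + g') f = comp g f + comp g' f;
  compDr : forall X Y Z (g : hom Y Z) (f f' : hom X Y),
    comp g (f + f') = comp g f + comp g f'
}.
Arguments hom {p} X Y.
Arguments idm {p} X.
Arguments comp {p X Y Z} g f.
Notation "g \c f" := (comp g f) (at level 40, left associativity).

Section CompTheory.
Variable A : preadditive.

Lemma comp0m (X Y Z : A) (f : hom X Y) : (0 : hom Y Z) \c f = 0.
Proof. by apply: (addrI (0 \c f)); rewrite -compDl !addr0. Qed.

Lemma compm0 (X Y Z : A) (g : hom Y Z) : g \c (0 : hom X Y) = 0.
Proof. by apply: (addrI (g \c 0)); rewrite -compDr !addr0. Qed.

Lemma compNm (X Y Z : A) (g : hom Y Z) (f : hom X Y) : (- g) \c f = - (g \c f).
Proof. by apply: (addrI (g \c f)); rewrite -compDl !subrr comp0m. Qed.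

Lemma compmN (X Y Z : A) (g : hom Y Z) (f : hom X Y) : g \c (- f) = - (g \c f).
Proof. by apply: (addrI (g \c f)); rewrite -compDr !subrr compm0. Qed.

End CompTheory.

Section CategoryNotions.
Variable A : preadditive.

Definition is_zero (X : A) : Prop :=
  (forall Y (f : hom X Y), f = 0) /\ (forall Y (f : hom Y X), f = 0).

Definition is_iso (X Y : A) (f : hom X Y) : Prop :=
  exists g : hom Y X, g \c f = idm X /\ f \c g = idm Y.

Definition isomorphic (X Y : A) : Prop := exists f : hom X Y, is_iso f.

Definition mono (X Y : A) (f : hom X Y) : Prop :=
  forall W (g h : hom W X), f \c g = f \c h -> g = h.

Definition epi (X Y : A) (f : hom X Y) : Prop :=
  forall Z (g h : hom Y Z), g \c f = h \c f -> g = h.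

Definition is_kernel (K X Y : A) (k : hom K X) (f : hom X Y) : Prop :=
  f \c k = 0 /\
  forall W (g : hom W X), f \c g = 0 -> exists! h : hom W K, k \c h = g.

Definition is_cokernel (X Y Q : A) (q : hom Y Q) (f : hom X Y) : Prop :=
  q \c f = 0 /\
  forall Z (g : hom Y Z), g \c f = 0 -> exists! h : hom Q Z, h \c q = g.

Definition is_biproduct (X Y S : A) : Prop :=
  exists (i1 : hom X S) (i2 : hom Y S) (p1 : hom S X) (p2 : hom S Y),
    [/\ p1 \c i1 = idm X, p2 \c i2 = idm Y, p1 \c i2 = 0, p2 \c i1 = 0
      & i1 \c p1 + i2 \c p2 = idm S].

Definition is_direct_sum (n : nat) (s : 'I_n -> A) (X : A) : Prop :=
  exists (i : forall k, hom (s k) X) (p : forall k, hom X (s k)),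
    [/\ forall k, p k \c i k = idm (s k),
        forall k l, k != l -> p k \c i l = 0
      & \sum_(k < n) i k \c p k = idm X].

Definition indecomposable (X : A) : Prop :=
  ~ is_zero X /\ forall Y Z, is_biproduct Y Z X -> is_zero Y \/ is_zero Z.

(* The endomorphism ring is nonzero and its non-units are stable under sum. *)
Definition local_end (X : A) : Prop :=
  idm X <> 0 /\
  forall f g : hom X X, is_iso (f + g) -> is_iso f \/ is_iso g.

(* This notion and the next ones are the usual ones in an abelian category. *)
Definition simple (X : A) : Prop :=
  ~ is_zero X /\ forall Y (m : hom Y X), mono m -> is_zero Y \/ is_iso m.

Definition projective (P : A) : Prop :=
  forall X Y (e : hom X Y) (f : hom P Y), epi e -> exists g, e \c g = f.

Definition simple_quotient (P L : A) (p : hom P L) : Prop := simple L /\ epi p.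

(* Quotients of P are compared by isomorphisms under P. *)
Definition unique_simple_quotient (P L : A) : Prop :=
  exists p : hom P L, simple_quotient p /\
    forall L' (p' : hom P L'), simple_quotient p' ->
      exists u : hom L L', is_iso u /\ u \c p = p'.

End CategoryNotions.

Section CategoryProperties.
Variable A : preadditive.

Definition additive_cat : Prop :=
  (exists Z : A, is_zero Z) /\ forall X Y : A, exists S, is_biproduct X Y S.

Definition abelian_cat : Prop :=
  [/\ additive_cat,
      forall (X Y : A) (f : hom X Y), exists K (k : hom K X), is_kernel k f,
      forall (X Y : A) (f : hom X Y), exists Q (q : hom Y Q), is_cokernel q f,
      forall (X Y : A) (f : hom X Y), mono f ->
        exists Z (g : hom Y Z), is_kernel f g
    & forall (X Y : A) (f : hom X Y), epi f ->
        exists Z (g : hom Z X), is_cokernel f g].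

Definition krull_schmidt : Prop :=
  forall X : A, exists (n : nat) (s : 'I_n -> A),
    (forall k, local_end (s k)) /\ is_direct_sum s X.

Definition enough_simples : Prop :=
  forall P : A, projective P -> indecomposable P ->
    exists L (p : hom P L), simple_quotient p.

End CategoryProperties.

Section FullSubcategory.
Variables (A : preadditive) (S : A -> Prop).

Definition full_sub : preadditive :=
  @Preadditive {X : A | S X} (fun X Y => hom (sval X) (sval Y))
    (fun X => idm (sval X)) (fun X Y Z g f => g \c f)
    (fun W X Y Z => @compA A (sval W) (sval X) (sval Y) (sval Z))
    (fun X Y => @comp1m A (sval X) (sval Y))
    (fun X Y => @compm1 A (sval X) (sval Y))
    (fun X Y Z => @compDl A (sval X) (sval Y) (sval Z))
    (fun X Y Z => @compDr A (sval X) (sval Y) (sval Z)).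

Definition strictly_full : Prop := forall X Y, isomorphic X Y -> S X -> S Y.

Definition karoubi_closed : Prop :=
  forall X Y Z, is_biproduct Y Z X -> S X -> S Y.

End FullSubcategory.

(* Bounded above cochain complexes. The differential is indexed by arbitrary
   pairs of degrees and vanishes outside of the pairs (i, i + 1); this avoids
   casts along equations between degrees. *)
Record bcomplex (A : preadditive) := BComplex {
  term :> int -> A;
  diff : forall i j, hom (term i) (term j);
  diff_shape : forall i j, j != i + 1 -> diff i j = 0;
  diffK : forall i j k, diff j k \c diff i j = 0;
  term_bounded : exists n : int, forall i, n < i -> is_zero (term i)
}.
Arguments diff {A} b i j.

Record chain_map (A : preadditive) (X Y : bcomplex A) := ChainMap {
  cmap :> forall i, hom (X i) (Y i);
  cmapP : forall i j, cmap j \c diff X i j = diff Y i j \c cmap i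
}.

Section ChainMaps.
Variable A : preadditive.
Implicit Types X Y Z W : bcomplex A.

HB.instance Definition _ X Y := gen_eqMixin (chain_map X Y).
HB.instance Definition _ X Y := gen_choiceMixin (chain_map X Y).

Lemma cmap_ext X Y (f g : chain_map X Y) : (forall i, f i = g i) -> f = g.
Proof.
case: f g => f fP [g gP] /= efg.
have efg' : f = g by apply: functional_extensionality_dep.
by case: _ / efg' in gP *; congr ChainMap; exact: Prop_irrelevance.
Qed.

Lemma cmap0P X Y i j : 0 \c diff X i j = diff Y i j \c 0.
Proof. by rewrite comp0m compm0. Qed.
Definition cmap0 X Y := ChainMap (@cmap0P X Y).

Lemma cmapNP X Y (f : chain_map X Y) i j :
  (- f j) \c diff X i j = diff Y i j \c (- f i).
Proof. by rewrite compNm compmN cmapP. Qed.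
Definition cmapN X Y (f : chain_map X Y) := ChainMap (cmapNP f).

Lemma cmapDP X Y (f g : chain_map X Y) i j :
  (f j + g j) \c diff X i j = diff Y i j \c (f i + g i).
Proof. by rewrite compDl compDr !cmapP. Qed.
Definition cmapD X Y (f g : chain_map X Y) := ChainMap (cmapDP f g).

Lemma cmap_addA X Y : associative (@cmapD X Y).
Proof. by move=> f g h; apply: cmap_ext => i /=; rewrite addrA. Qed.
Lemma cmap_addC X Y : commutative (@cmapD X Y).
Proof. by move=> f g; apply: cmap_ext => i /=; rewrite addrC. Qed.
Lemma cmap_add0 X Y : left_id (cmap0 X Y) (@cmapD X Y).
Proof. by move=> f; apply: cmap_ext => i /=; rewrite add0r. Qed.
Lemma cmap_addN X Y : left_inverse (cmap0 X Y) (@cmapN X Y) (@cmapD X Y).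
Proof. by move=> f; apply: cmap_ext => i /=; rewrite addNr. Qed.

HB.instance Definition _ X Y := GRing.isZmodule.Build (chain_map X Y)
  (@cmap_addA X Y) (@cmap_addC X Y) (@cmap_add0 X Y) (@cmap_addN X Y).

Lemma cmap_id_proof X i j : idm (X j) \c diff X i j = diff X i j \c idm (X i).
Proof. by rewrite comp1m compm1. Qed.
Definition cmap_id X := ChainMap (@cmap_id_proof X).

Lemma cmap_comp_proof X Y Z (g : chain_map Y Z) (f : chain_map X Y) i j :
  (g j \c f j) \c diff X i j = diff Z i j \c (g i \c f i).
Proof. by rewrite -compA cmapP compA cmapP compA. Qed.
Definition cmap_comp X Y Z (g : chain_map Y Z) (f : chain_map X Y) :=
  ChainMap (cmap_comp_proof g f).

Definition nullhomotopy X Y (f : chain_map X Y)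
    (s : forall i j : int, hom (X i) (Y j)) : Prop :=
  forall i, f i = s (i + 1) i \c diff X i (i + 1)
                  + diff Y (i - 1) i \c s i (i - 1).

Definition nullhomotopic X Y (f : chain_map X Y) : bool :=
  `[< exists s, nullhomotopy f s >].

Lemma nullhomotopic_closed X Y : zmod_closed (@nullhomotopic X Y).
Proof.
split=> [|f g].
  apply/asboolP; exists (fun _ _ => 0) => i /=.
  by rewrite comp0m compm0 addr0.
move=> /asboolP[s hs] /asboolP[t ht]; apply/asboolP.
exists (fun i j => s i j - t i j) => i /=.
by rewrite hs ht !compDl !compDr !compNm !compmN opprD addrACA.
Qed.

HB.instance Definition _ X Y :=
  GRing.isZmodClosed.Build (chain_map X Y) (@nullhomotopic X Y)
    (@nullhomotopic_closed X Y).

Definition khom X Y : zmodType :=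
  Quotient.quot (GRing.ZmodClosed.clone _ (@nullhomotopic X Y) _).

Definition kclass X Y (f : chain_map X Y) : khom X Y := \pi_(khom X Y) f.
Definition krepr X Y (f : khom X Y) : chain_map X Y := repr f.

Lemma kreprK X Y (f : khom X Y) : kclass (krepr f) = f.
Proof. exact: reprK. Qed.

Lemma kclass_eq X Y (f g : chain_map X Y) :
  kclass f = kclass g <-> exists s, nullhomotopy (f - g) s.
Proof.
split=> [/eqP|h].
  by rewrite /kclass -Quotient.idealrBE => /asboolP.
by apply/eqP; rewrite /kclass -Quotient.idealrBE; apply/asboolP.
Qed.

Lemma kclassD X Y (f g : chain_map X Y) :
  kclass (f + g) = kclass f + kclass g.
Proof. by rewrite /kclass raddfD. Qed.

Definition kid X : khom X X := kclass (cmap_id X).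
Definition kcomp X Y Z (g : khom Y Z) (f : khom X Y) : khom X Z :=
  kclass (cmap_comp (krepr g) (krepr f)).

Lemma kclass_comp X Y Z (g : chain_map Y Z) (f : chain_map X Y) :
  kcomp (kclass g) (kclass f) = kclass (cmap_comp g f).
Proof.
have /kclass_eq[s hs] := kreprK (kclass g).
have /kclass_eq[t ht] := kreprK (kclass f).
rewrite /kcomp; set g' := krepr _ in hs *; set f' := krepr _ in ht *.
apply/kclass_eq; exists (fun i j => s i j \c f' i + g j \c t i j) => i /=.
have -> : g' i \c f' i - g i \c f i
        = (g' - g) i \c f' i + g i \c (f' - f) i.
  by rewrite /= compDl compDr compNm compmN addrA addrNK.
rewrite hs ht !compDl !compDr -!compA !cmapP !compA cmapP.
by rewrite !addrA; congr (_ + _); rewrite addrAC.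
Qed.

Lemma kcompA W X Y Z (h : khom Y Z) (g : khom X Y) (f : khom W X) :
  kcomp h (kcomp g f) = kcomp (kcomp h g) f.
Proof.
rewrite -[h]kreprK -[g]kreprK -[f]kreprK !kclass_comp; congr kclass.
by apply: cmap_ext => i /=; rewrite compA.
Qed.

Lemma kcomp1m X Y (f : khom X Y) : kcomp (kid Y) f = f.
Proof.
rewrite -[f]kreprK kclass_comp; congr kclass.
by apply: cmap_ext => i /=; rewrite comp1m.
Qed.

Lemma kcompm1 X Y (f : khom X Y) : kcomp f (kid X) = f.
Proof.
rewrite -[f]kreprK kclass_comp; congr kclass.
by apply: cmap_ext => i /=; rewrite compm1.
Qed.

Lemma kcompDl X Y Z (g g' : khom Y Z) (f : khom X Y) :
  kcomp (g + g') f = kcomp g f + kcomp g' f.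
Proof.
rewrite -[g]kreprK -[g']kreprK -[f]kreprK -kclassD !kclass_comp -kclassD.
by congr kclass; apply: cmap_ext => i /=; rewrite compDl.
Qed.

Lemma kcompDr X Y Z (g : khom Y Z) (f f' : khom X Y) :
  kcomp g (f + f') = kcomp g f + kcomp g f'.
Proof.
rewrite -[g]kreprK -[f]kreprK -[f']kreprK -kclassD !kclass_comp -kclassD.
by congr kclass; apply: cmap_ext => i /=; rewrite compDr.
Qed.

End ChainMaps.

Definition Kminus (A : preadditive) : preadditive :=
  @Preadditive (bcomplex A) (@khom A) (@kid A) (@kcomp A) (@kcompA A)
    (@kcomp1m A) (@kcompm1 A) (@kcompDl A) (@kcompDr A).

Section Shift.
Variables (A : preadditive) (X : bcomplex A).

Lemma shift_shape (i j : int) : j != i + 1 -> - diff X (i + 1) (j + 1) = 0.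
Proof.
by move=> nij; rewrite diff_shape ?oppr0 // (inj_eq (addIr _)).
Qed.

Lemma shift_diffK (i j k : int) :
  (- diff X (j + 1) (k + 1)) \c (- diff X (i + 1) (j + 1)) = 0.
Proof. by rewrite compNm compmN opprK diffK. Qed.

Lemma shift_bounded :
  exists n : int, forall i, n < i -> is_zero (X (i + 1)).
Proof.
have [n hn] := term_bounded X; exists n => i ni; apply: hn.
by apply: lt_trans ni _; rewrite ltrDl.
Qed.

(* The translate X[1]. *)
Definition shift : bcomplex A := BComplex shift_shape shift_diffK shift_bounded.

End Shift.

Section Stalk.
Variables (A : preadditive) (O : A) (hO : is_zero O) (M : A).

Definition stalk_term (i : int) : A := if i == 0 then M else O.

Lemma stalk_shape (i j : int) : j != i + 1 ->
  (0 : hom (stalk_term i) (stalk_term j)) = 0.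
Proof. by []. Qed.

Lemma stalk_diffK (i j k : int) :
  (0 : hom (stalk_term j) (stalk_term k))
    \c (0 : hom (stalk_term i) (stalk_term j)) = 0.
Proof. exact: comp0m. Qed.

Lemma stalk_bounded :
  exists n : int, forall i, n < i -> is_zero (stalk_term i).
Proof. by exists 0 => i i_gt0; rewrite /stalk_term gt_eqF. Qed.

Definition stalk : bcomplex A := BComplex stalk_shape stalk_diffK stalk_bounded.

End Stalk.

Section Cohomology.
Variable A : preadditive.

(* H^i(X) is the cokernel of the map X^(i-1) -> Ker(d^i) induced by d^(i-1). *)
Record cohomology (X : bcomplex A) (i : int) := Cohomology {
  coh_cycles : A;
  coh_incl : hom coh_cycles (X i);
  coh_inclP : is_kernel coh_incl (diff X i (i + 1));
  coh_bound : hom (X (i - 1)) coh_cycles;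
  coh_boundP : coh_incl \c coh_bound = diff X (i - 1) i;
  coh_obj : A;
  coh_proj : hom coh_cycles coh_obj;
  coh_projP : is_cokernel coh_proj coh_bound
}.

Definition induced_on_cohomology (X Y : bcomplex A) (f : chain_map X Y)
    (i : int) (HX : cohomology X i) (HY : cohomology Y i)
    (h : hom (coh_obj HX) (coh_obj HY)) : Prop :=
  exists z : hom (coh_cycles HX) (coh_cycles HY),
    coh_incl HY \c z = f i \c coh_incl HX /\
    h \c coh_proj HX = coh_proj HY \c z.

Definition quasi_iso (X Y : bcomplex A) (f : chain_map X Y) : Prop :=
  forall i (HX : cohomology X i) (HY : cohomology Y i),
    exists h : hom (coh_obj HX) (coh_obj HY),
      induced_on_cohomology f h /\ is_iso h.

Definition no_cohomology (X : bcomplex A) (i : int) : Prop :=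
  forall H : cohomology X i, is_zero (coh_obj H).

End Cohomology.

Definition heartA_pred (A : preadditive) (X : Kminus A) : Prop :=
  (forall i : int, (i < -2%:Z) || (0 < i) -> is_zero (term X i)) /\
  (forall i : int, i < 0 -> no_cohomology X i).

Definition heartA (A : preadditive) : preadditive :=
  full_sub (@heartA_pred A).

(* K^-(C) is seen as a full subcategory of K^-(A), and the t-structure on K^-(C)
   as a pair of predicates on the objects of K^-(A). *)
Section Subcategory.
Variables (A : preadditive) (C : A -> Prop).

Definition T_C (X : Kminus A) : Prop := forall i : int, C (term X i).

Definition T_C_le0 (X : Kminus A) : Prop :=
  T_C X /\ exists Y : Kminus A,
    [/\ T_C Y, forall i : int, 0 < i -> is_zero (term Y i) & isomorphic X Y].

Definition T_C_ge0 (X : Kminus A) : Prop :=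
  T_C X /\ forall Y : Kminus A, T_C_le0 Y ->
    forall f : @hom (Kminus A) (shift Y) X, f = 0.

Definition heartC_pred (X : Kminus A) : Prop := T_C_le0 X /\ T_C_ge0 X.

Definition heartC : preadditive := full_sub heartC_pred.

Definition is_approximation (X XC : Kminus A) : Prop :=
  T_C XC /\ exists f : chain_map XC X, quasi_iso f /\
    forall Y : Kminus A, T_C Y ->
      bijective (fun h : hom Y XC => (kclass f : hom XC X) \c h).

Definition approximating : Prop :=
  forall X : Kminus A, exists XC, is_approximation X XC.

(* The right adjoint of the inclusion of K^-(C), on objects. *)
Definition pi_C (hC : approximating) (X : Kminus A) : Kminus A :=
  projT1 (cid (hC X)).

End Subcategory.

Section Projectives.
Variables (A : preadditive) (hA : abelian_cat A).

Definition zero_obj : A :=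
  projT1 (cid (let: And5 (conj h _) _ _ _ _ := hA in h)).

Lemma zero_objP : is_zero zero_obj.
Proof. exact: projT2 (cid _). Qed.

Definition stalk0 (M : A) : Kminus A := stalk zero_objP M.

Lemma stalk0_term (M : A) (i : int) : i != 0 -> is_zero (term (stalk0 M) i).
Proof.
by move=> /negPf i0; rewrite /= /stalk_term i0; exact: zero_objP.
Qed.

Lemma stalk0_heartA (M : A) : heartA_pred (stalk0 M).
Proof.
split=> [i hi|i i_lt0 H].
  apply: stalk0_term; apply/eqP => i0; by rewrite i0 in hi.
have zX : is_zero (term (stalk0 M) i) by apply: stalk0_term; rewrite lt_eqF.
have [_ ker_uniq] := coh_inclP H.
have zZ : idm (coh_cycles H) = 0.
  have e0 : diff (stalk0 M) i (i + 1) \c (0 : hom (coh_cycles H) _) = 0.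
    exact: compm0.
  have [h [_ hu]] := ker_uniq _ _ e0.
  rewrite -(hu (idm _)); last by rewrite compm1 (zX.2 _ (coh_incl H)).
  by rewrite -(hu 0) // compm0.
have p0 : coh_proj H = 0 by rewrite -[coh_proj H]compm1 zZ compm0.
have [_ cok_uniq] := coh_projP H.
have z1 : idm (coh_obj H) = 0.
  have e0 : (0 : hom _ (coh_obj H)) \c coh_bound H = 0 by exact: comp0m.
  have [h [_ hu]] := cok_uniq _ _ e0.
  rewrite -(hu (idm _)); last by rewrite comp1m.
  by rewrite -(hu 0) // comp0m.
split=> Y f; first by rewrite -[f]compm1 z1 compm0.
by rewrite -[f]comp1m z1 comp0m.
Qed.

(* The object P_M of H_A. *)
Definition P_A (M : A) : heartA A := exist _ (stalk0 M) (stalk0_heartA M).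

Variables (C : A -> Prop) (addC : additive_cat (full_sub C)).
Hypothesis isoC : strictly_full C.

Lemma zero_objC : C zero_obj.
Proof.
have [[W [W0 _]] _] := addC.
have W1 : idm (sval W) = 0 by exact: (W0 W).
have O1 : idm zero_obj = 0 by exact: zero_objP.1.
by apply: isoC (svalP W); exists 0; exists 0; rewrite !compm0 W1 O1.
Qed.

Lemma stalk0_T_C (M : A) : C M -> T_C C (stalk0 M).
Proof.
by move=> CM i; rewrite /= /stalk_term; case: ifP => // _; exact: zero_objC.
Qed.

Lemma stalk0_le0 (M : A) : C M -> T_C_le0 C (stalk0 M).
Proof.
move=> CM; split; first exact: stalk0_T_C.
exists (stalk0 M); split; first exact: stalk0_T_C.
  by move=> i i_gt0; apply: stalk0_term; rewrite gt_eqF.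
by exists (idm _); exists (idm _); split; exact: comp1m.
Qed.

Lemma stalk0_ge0 (M : A) : C M -> T_C_ge0 C (stalk0 M).
Proof.
move=> CM; split=> [|Y [_ [Y' [_ Y'0 [u [v [vu _]]]]]] f]; first exact: stalk0_T_C.
have {vu} : kcomp v u = kid Y := vu.
rewrite /kcomp => /kclass_eq[s hs].
rewrite -[f]kreprK; set f' : chain_map (shift Y) (stalk0 M) := krepr f.
suff -> : kclass f' = kclass 0 by exact: raddf0.
apply/kclass_eq; exists (fun i j => f' j \c s (i + 1) (j + 1)) => i.
have -> : (f' - 0) i = f' i by rewrite subr0.
rewrite [X in _ + X]comp0m addr0.
have [i0|] := eqVneq i 0; last first.
  by move=> /(stalk0_term M)[_ z]; rewrite [LHS]z [RHS]z.
have i1 : 0 < i + 1 by rewrite i0.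
have fd j : f' i \c diff Y (j + 1) (i + 1) = 0.
  have := cmapP f' j i.
  rewrite [X in _ = X]comp0m /= compmN => /eqP.
  by rewrite oppr_eq0 => /eqP.
have fdk k : f' i \c diff Y k (i + 1) = 0 by rewrite -(subrK 1 k).
have := hs (i + 1); rewrite /= ((Y'0 _ i1).2 _ (krepr u (i + 1))) compm0 add0r.
move=> /(congr1 (comp (f' i))).
rewrite compDr !compA fdk comp0m addr0 => e.
by rewrite [RHS]compmN -e compmN opprK [RHS]compm1.
Qed.

Lemma stalk0_heartC (M : full_sub C) : heartC_pred C (stalk0 (sval M)).
Proof. by split; [apply: stalk0_le0 | apply: stalk0_ge0]; exact: svalP M. Qed.

(* The object P_M of H_C. *)
Definition P_C (M : full_sub C) : heartC C :=
  exist _ (stalk0 (sval M)) (stalk0_heartC M).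

End Projectives.

(* Main.v *)
(* An object X of either heart has a presentation P_M1 -> P_M0 -> X -> 0, and it
   behaves like the finitely presented functor M |-> Hom(P_M, X): an epimorphism
   is surjective on maps from the P_M, and a map out of X is a map out of P_M0
   killing P_M1. Under this dictionary pi_C is the restriction of functors from A
   to C. If Z has a local endomorphism ring, a simple quotient p : P_Z -> L kills
   exactly the f : M -> Z that are not split epimorphisms. The restriction of L to
   C is therefore simple if Z is in C; otherwise it vanishes, since no f : M -> Z
   with M in C splits, C being closed under direct summands.

   Maps out of X are computed without resolutions: in both hearts
   Hom(Y, X) = 0 as soon as Y vanishes in degrees >= 0, and this is applied to
   brutal truncations. A C-approximation of an object of H_A is exact on C in
   positive degrees, hence splits off its positive part and lies in H_C. *)

From mathcomp Require Import all_boot all_order all_algebra.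
From mathcomp Require Import boolp zify.
Require Import Defs.

Set Implicit Arguments.
Unset Strict Implicit.
Unset Printing Implicit Defensive.

Import Order.TTheory GRing.Theory Num.Theory.
Local Open Scope ring_scope.

(** * Homotopy classes of maps from stalk complexes *)

Section Preadditive.
Variable A : preadditive.
Implicit Types X Y Z : A.

Lemma is_zeroP X : is_zero X <-> idm X = 0.
Proof.
split=> [[z _]|z]; first exact: z.
by split=> Y f; [rewrite -[f]compm1 z compm0 | rewrite -[f]comp1m z comp0m].
Qed.

Lemma is_zero_retract X Y (i : hom Y X) (p : hom X Y) :
  p \c i = idm Y -> is_zero X -> is_zero Y.
Proof. by move=> pi [_ z]; apply/is_zeroP; rewrite -pi (z _ i) compm0. Qed.

Lemma isomorphic_sym X Y : isomorphic X Y -> isomorphic Y X.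
Proof. by case=> u [v [vu uv]]; exists v, u. Qed.

Lemma is_zero_iso X Y : isomorphic X Y -> is_zero X -> is_zero Y.
Proof. by case=> u [v [_ uv]]; exact: is_zero_retract uv. Qed.

Lemma is_iso_comp X Y Z (g : hom Y Z) (f : hom X Y) :
  is_iso g -> is_iso f -> is_iso (g \c f).
Proof.
move=> [g' [gg' g'g]] [f' [ff' f'f]]; exists (f' \c g').
by rewrite !compA -(compA f') gg' compm1 -(compA g) f'f compm1.
Qed.

Lemma isomorphic_refl X : isomorphic X X.
Proof. by exists (idm X), (idm X); rewrite comp1m. Qed.

End Preadditive.

Section HomotopyClasses.
Variable A : preadditive.

Lemma kclass_eq0 (X Y : bcomplex A) (f : chain_map X Y) :
  kclass f = 0 <-> exists s, nullhomotopy f s.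
Proof. by rewrite -{2}[f]subr0 -kclass_eq; rewrite [kclass 0]raddf0. Qed.

Lemma kclassB (X Y : bcomplex A) (f g : chain_map X Y) :
  kclass (f - g) = kclass f - kclass g.
Proof. by rewrite /kclass raddfB. Qed.

End HomotopyClasses.

Section StalkMaps.
Variables (A : preadditive) (abA : abelian_cat A).
Local Notation K := (Kminus A).
Local Notation P := (stalk0 abA).

Section StalkMap.
Variables (M : A) (X : bcomplex A) (y : hom M (X 0)).
Hypothesis hy : diff X 0 1 \c y = 0.

(** The family is zero except for [y] in degree 0; overriding one value by [dfwith] avoids a cast
    along [i = 0]. *)
Definition stalk_map_fun : forall i, hom (stalk_term (zero_obj abA) M i) (X i) :=
  dfwith (T := fun i => hom (stalk_term (zero_obj abA) M i) (X i))
    (fun _ => 0) (i := 0) y.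

Lemma stalk_mapP i j :
  stalk_map_fun j \c diff (P M : bcomplex A) i j = diff X i j \c stalk_map_fun i.
Proof.
rewrite [LHS]compm0 /stalk_map_fun; case: dfwithP => [|k _]; last by rewrite compm0.
have [->|j1] := eqVneq j 1; first by rewrite hy.
by rewrite diff_shape ?comp0m.
Qed.

Definition stalk_map : chain_map (P M : bcomplex A) X := ChainMap stalk_mapP.

Lemma stalk_mapE : stalk_map 0 = y.
Proof. exact: (dfwith_in (T := fun i => hom (stalk_term _ M i) (X i))). Qed.

End StalkMap.

Lemma stalk_map_ext M (X : bcomplex A) (f g : chain_map (P M : bcomplex A) X) :
  f 0 = g 0 -> f = g.
Proof.
move=> fg; apply: cmap_ext => i; have [->//|i0] := eqVneq i 0.
by have [z _] := stalk0_term abA M i0; rewrite [LHS]z [RHS]z.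
Qed.

(** A stalk has no differential and only its degree 0 matters, so the single relevant component of a
    homotopy goes from degree 0 to degree -1. Together with [stalk_homP] this identifies maps from
    [P M] with cycles M -> X^0 modulo boundaries. *)
Lemma stalk_map_nullP M (X : bcomplex A) (f : chain_map (P M : bcomplex A) X) :
  kclass f = 0 <-> exists s : hom M (X (-1)), f 0 = diff X (-1) 0 \c s.
Proof.
rewrite kclass_eq0; split=> [[s /(_ 0)]|[s fs]].
  by rewrite [X in X + _]compm0 add0r; exists (s 0 (-1)).
pose T i j := hom (stalk_term (zero_obj abA) M i) (X j).
exists (dfwith (T := fun i => forall j, T i j) (fun _ _ => 0) (i := 0)
          (dfwith (T := T 0) (fun _ => 0) (i := -1) s)) => i.
have [->|i0] := eqVneq i 0; last first.
  by have [z _] := stalk0_term abA M i0; rewrite [LHS]z [RHS]z.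
rewrite [X in X + _]compm0 add0r dfwith_in fs; congr (_ \c _).
by rewrite -[LHS](dfwith_in (T := T 0) (fun _ => 0)).
Qed.

Lemma stalk_homP M (X : bcomplex A) (F : @hom K (P M) X) :
  exists y (hy : diff X 0 1 \c y = 0), F = kclass (stalk_map hy).
Proof.
rewrite -[F]kreprK; set f := krepr F.
have hy : diff X 0 1 \c f 0 = 0 by rewrite -cmapP compm0.
by exists (f 0), hy; refine (congr1 (@kclass A _ _) (stalk_map_ext _)); rewrite stalk_mapE.
Qed.

Definition Pmap M N (f : hom M N) : @hom K (P M) (P N) :=
  kclass (@stalk_map M (P N : bcomplex A) f (comp0m _ _)).

Lemma stalk_map_comp M N (X : bcomplex A) (f : hom M N) (y : hom N (X 0))
    (hy : diff X 0 1 \c y = 0) (hyf : diff X 0 1 \c (y \c f) = 0) :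
  (kclass (stalk_map hy) : @hom K (P N) X) \c Pmap f = kclass (stalk_map hyf).
Proof.
rewrite /Pmap [LHS]kclass_comp; refine (congr1 (@kclass A _ _) (stalk_map_ext _)).
rewrite stalk_mapE; exact: (congr2 (@comp A _ _ _) (stalk_mapE _) (stalk_mapE _)).
Qed.

Lemma Pmap1 M : Pmap (idm M) = idm (P M).
Proof. by refine (congr1 (@kclass A _ _) (stalk_map_ext _)); exact: stalk_mapE. Qed.

Lemma PmapM L M N (g : hom M N) (f : hom L M) : Pmap (g \c f) = Pmap g \c Pmap f.
Proof. exact/esym/(@stalk_map_comp L M (P N : bcomplex A) f g). Qed.

Lemma PmapD M N (f g : hom M N) : Pmap (f + g) = Pmap f + Pmap g.
Proof.
rewrite -[RHS]kclassD; refine (congr1 (@kclass A _ _) (stalk_map_ext _)).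
rewrite stalk_mapE; exact/esym/(congr2 +%R (stalk_mapE _) (stalk_mapE _)).
Qed.

Lemma Pmap0 M N : Pmap (0 : hom M N) = 0.
Proof. by apply: (addrI (Pmap 0)); rewrite -PmapD !addr0. Qed.

Lemma PmapN M N (f : hom M N) : Pmap (- f) = - Pmap f.
Proof. by apply: (addrI (Pmap f)); rewrite -PmapD !subrr Pmap0. Qed.

Lemma PmapB M N (f g : hom M N) : Pmap (f - g) = Pmap f - Pmap g.
Proof. by rewrite PmapD PmapN. Qed.

(** A homotopy would pass through degree -1 of [P N], which vanishes. *)
Lemma Pmap_eq0 M N (f : hom M N) : Pmap f = 0 -> f = 0.
Proof.
by move=> /stalk_map_nullP[s]; rewrite stalk_mapE => ->; exact: comp0m.
Qed.

Lemma Pmap_inj M N (f g : hom M N) : Pmap f = Pmap g -> f = g.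
Proof.
by move=> fg; apply/eqP; rewrite -subr_eq0; apply/eqP/Pmap_eq0; rewrite PmapB fg subrr.
Qed.

Lemma Pmap_full M N (F : @hom K (P M) (P N)) : exists f, F = Pmap f.
Proof.
have [y [hy ->]] := stalk_homP F; exists y.
by refine (congr1 (@kclass A _ _) (stalk_map_ext _)); rewrite !stalk_mapE.
Qed.

End StalkMaps.
(** * Shifts and truncations *)

Section Complexes.
Variable A : preadditive.
Implicit Types X Y Z : bcomplex A.

(** An identity morphism between terms whose degrees are equal but not convertible, such as
    [i + 1 - 1] and [i]. *)
Definition transport (X : int -> A) i j (e : i = j) : hom (X i) (X j) :=
  ecast k (hom (X i) (X k)) e (idm (X i)).

Lemma diff_transport X i i' j j' (e : i = i') (e' : j = j') :
  diff X i' j' \c transport X e = transport X e' \c diff X i j.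
Proof. by case: _ / e; case: _ / e'; rewrite compm1 comp1m. Qed.

Lemma transport1 (X : int -> A) i (e : i = i) : transport X e = idm (X i).
Proof. by rewrite (eq_axiomK e). Qed.

Lemma transportK (X : int -> A) i j (e : i = j) (e' : j = i) :
  transport X e' \c transport X e = idm (X i).
Proof. by case: _ / e in e' *; rewrite (eq_axiomK e') comp1m. Qed.

(** Both composites of d h + h d with d reduce to d h d. Chain maps can thus be corrected by an
    arbitrary family [h]. *)
Lemma nullhomotopic_map X Y (h : forall i j : int, hom (X i) (Y j)) :
  exists f : chain_map X Y, nullhomotopy f h.
Proof.
pose f i := h (i + 1) i \c diff X i (i + 1) + diff Y (i - 1) i \c h i (i - 1).
suff fP i j : f j \c diff X i j = diff Y i j \c f i by exists (ChainMap fP).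
have [->|ij] := eqVneq j (i + 1); last by rewrite !diff_shape ?comp0m ?compm0.
rewrite /f compDl compDr -!compA diffK compm0 add0r.
by rewrite [diff Y i _ \c (diff _ _ _ \c _)]compA diffK comp0m addr0 addrK.
Qed.

Lemma unshift_shape X (i j : int) : j != i + 1 -> - diff X (i - 1) (j - 1) = 0.
Proof. by move=> ij; rewrite diff_shape ?oppr0 //; lia. Qed.

Lemma unshift_diffK X (i j k : int) :
  (- diff X (j - 1) (k - 1)) \c (- diff X (i - 1) (j - 1)) = 0.
Proof. by rewrite compNm compmN opprK diffK. Qed.

Lemma unshift_bounded X : exists n : int, forall i, n < i -> is_zero (X (i - 1)).
Proof. by have [n hn] := term_bounded X; exists (n + 1) => i ni; apply: hn; lia. Qed.

Definition unshift X : bcomplex A :=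
  BComplex (@unshift_shape X) (@unshift_diffK X) (unshift_bounded X).

Lemma shift_unshiftP X (i j : int) :
  transport X (addrK 1 j) \c diff (shift (unshift X)) i j
  = diff X i j \c transport X (addrK 1 i).
Proof.
have -> : diff (shift (unshift X)) i j = diff X (i + 1 - 1) (j + 1 - 1) by exact: opprK.
exact: (esym (diff_transport X (addrK 1 i) (addrK 1 j))).
Qed.

Lemma unshift_shiftP X (i j : int) :
  transport X (esym (addrK 1 j)) \c diff X i j
  = diff (shift (unshift X)) i j \c transport X (esym (addrK 1 i)).
Proof.
have -> : diff (shift (unshift X)) i j = diff X (i + 1 - 1) (j + 1 - 1) by exact: opprK.
exact: (esym (diff_transport X (esym (addrK 1 i)) (esym (addrK 1 j)))).
Qed.

Lemma shift_unshift X : @isomorphic (Kminus A) (shift (unshift X)) X.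
Proof.
exists (kclass (@ChainMap _ (shift (unshift X)) X _ (@shift_unshiftP X))).
exists (kclass (@ChainMap _ X (shift (unshift X)) _ (@unshift_shiftP X))).
split; rewrite [LHS]kclass_comp; refine (congr1 (@kclass A _ _) (cmap_ext _)) => i.
  exact: (transportK X (addrK 1 i) (esym (addrK 1 i))).
exact: (transportK X (esym (addrK 1 i)) (addrK 1 i)).
Qed.

Section ShiftMap.
Variables (X Y : bcomplex A) (f : chain_map X Y).

Lemma shift_mapP (i j : int) :
  f (j + 1) \c diff (shift X) i j = diff (shift Y) i j \c f (i + 1).
Proof. rewrite [LHS]compmN [RHS]compNm; congr (- _); exact: (cmapP f (i + 1) (j + 1)). Qed.

Definition shift_map : chain_map (shift X) (shift Y) :=
  @ChainMap _ (shift X) (shift Y) _ shift_mapP.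

(** The translate negates differentials, so the homotopy changes sign as well. *)
Lemma shift_map_null s : nullhomotopy f s ->
  nullhomotopy shift_map (fun i j => - s (i + 1) (j + 1)).
Proof.
move=> fs i; rewrite [LHS]fs [X in _ = X + _]compmN [X in _ = _ + X]compNm.
rewrite [X in _ = - X + _]compNm [X in _ = _ - X]compmN !opprK.
by congr (_ + _); have -> : i + 1 - 1 = i - 1 + 1 :> int by lia.
Qed.

End ShiftMap.

Lemma shift_map_eq X Y (f g : chain_map X Y) :
  kclass f = kclass g -> kclass (shift_map f) = kclass (shift_map g).
Proof.
move=> /kclass_eq[s fgs]; apply/kclass_eq.
by exists (fun i j => - s (i + 1) (j + 1)); exact: (shift_map_null (f := f - g)).
Qed.

Lemma shift_iso X Y : @isomorphic (Kminus A) X Y ->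
  @isomorphic (Kminus A) (shift X) (shift Y).
Proof.
case=> u [v [vu uv]]; exists (kclass (shift_map (krepr u))).
exists (kclass (shift_map (krepr v))); split.
- transitivity (kclass (shift_map (cmap_comp (krepr v) (krepr u)))).
    by rewrite [LHS]kclass_comp; refine (congr1 (@kclass A _ _) (cmap_ext _)) => i.
  rewrite (shift_map_eq (g := cmap_id X) vu).
  by refine (congr1 (@kclass A _ _) (cmap_ext _)) => i.
- transitivity (kclass (shift_map (cmap_comp (krepr u) (krepr v)))).
    by rewrite [LHS]kclass_comp; refine (congr1 (@kclass A _ _) (cmap_ext _)) => i.
  rewrite (shift_map_eq (g := cmap_id Y) uv).
  by refine (congr1 (@kclass A _ _) (cmap_ext _)) => i.
Qed.

End Complexes.

(** * Brutal truncations *)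

Section Cut.
Variables (A : preadditive) (O : A) (hO : is_zero O) (p : pred int).
Hypothesis p_down : forall i : int, p (i + 1) -> p i.

Section CutTerm.
Variable X : int -> A.

Definition cut_term i : A := if p i then X i else O.

Definition cut_pr i : hom (X i) (cut_term i) :=
  if p i as b return hom (X i) (if b then X i else O) then idm _ else 0.

Definition cut_in i : hom (cut_term i) (X i) :=
  if p i as b return hom (if b then X i else O) (X i) then idm _ else 0.

Lemma cut_inK i : p i -> cut_in i \c cut_pr i = idm (X i).
Proof. by rewrite /cut_pr /cut_in /cut_term; case: (p i); rewrite // comp1m. Qed.

Lemma cut_term0 i : ~~ p i -> is_zero (cut_term i).
Proof. by rewrite /cut_term => /negPf->. Qed.

End CutTerm.

Variable X : bcomplex A.

(** The discarded degrees form a subcomplex: if [p i] fails then so does [p (i + 1)], and the target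
    is zero. The truncation is therefore a quotient of [X]. *)
Lemma cut_diff_pr i j :
  cut_pr X j \c diff X i j = cut_pr X j \c diff X i j \c cut_in X i \c cut_pr X i.
Proof.
have [pi|npi] := boolP (p i); first by rewrite -[RHS]compA cut_inK // compm1.
have [ji|ji] := eqVneq j (i + 1); last by rewrite diff_shape // !compm0 !comp0m.
have [_ z] : is_zero (cut_term X j).
  by apply: cut_term0; apply: contra npi; rewrite ji => /p_down.
by rewrite [LHS]z [RHS]z.
Qed.

Lemma cut_shape i j : j != i + 1 -> cut_pr X j \c diff X i j \c cut_in X i = 0.
Proof. by move=> ij; rewrite diff_shape // compm0 comp0m. Qed.

Lemma cut_diffK i j k :
  (cut_pr X k \c diff X j k \c cut_in X j)
    \c (cut_pr X j \c diff X i j \c cut_in X i) = 0.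
Proof.
by rewrite !compA -cut_diff_pr -(compA _ (diff X j k)) diffK compm0 comp0m.
Qed.

Lemma cut_bounded : exists n : int, forall i, n < i -> is_zero (cut_term X i).
Proof.
have [n hn] := term_bounded X; exists n => i /hn; rewrite /cut_term.
by case: (p i).
Qed.

Definition cut : bcomplex A := BComplex cut_shape cut_diffK cut_bounded.

Lemma cut_prP i j : cut_pr X j \c diff X i j = diff cut i j \c cut_pr X i.
Proof. exact: cut_diff_pr. Qed.

Definition cut_map : chain_map X cut := @ChainMap _ X cut _ cut_prP.

Lemma cut_factor (Z : bcomplex A) (f : chain_map X Z) :
  (forall i, ~~ p i -> f i = 0) -> exists g : chain_map cut Z, f = cmap_comp g cut_map.
Proof.
move=> f0.
have fE i : f i \c cut_in X i \c cut_pr X i = f i.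
  have [pi|/f0->] := boolP (p i); last by rewrite !comp0m.
  by rewrite -compA cut_inK ?compm1.
have gP i j : f j \c cut_in X j \c diff cut i j = diff Z i j \c (f i \c cut_in X i).
  by rewrite /= !compA fE cmapP.
by exists (@ChainMap _ cut Z _ gP); apply: cmap_ext => i; rewrite /= fE.
Qed.

End Cut.
(** * Presentations of the objects of the hearts *)

Section Orthogonality.
Variables (A : preadditive) (S : A -> Prop).

(** Up to isomorphism such [Y] are the translates by [1] of complexes over [S] without positive
    degrees, so this is the condition defining the >= 0 part of the t-structure. *)
Definition orthogonal (Z : bcomplex A) : Prop :=
  forall Y : bcomplex A, T_C S Y -> (forall i : int, 0 <= i -> is_zero (Y i)) ->
    forall f : khom Y Z, f = 0.

Variables (O : A) (hO : is_zero O) (SO : S O).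
Variables (X Z : bcomplex A).
Hypothesis SX : T_C S X.
Hypothesis X0 : forall i : int, 0 < i -> is_zero (X i).
Hypothesis oZ : orthogonal Z.

(** Taken as a homotopy supported at (0, -1), [s] gives a null homotopic [g] that agrees with [f] in
    degree 0. The difference factors through the truncation of [X] to negative degrees, from which
    every map to [Z] is zero. *)
Lemma orthogonal_faithful (f : chain_map X Z) (s : hom (X 0) (Z (-1))) :
  f 0 = diff Z (-1) 0 \c s -> kclass f = 0.
Proof.
move=> f0; pose T i j := hom (X i) (Z j).
pose h := dfwith (T := fun i => forall j, T i j) (fun _ _ => 0) (i := 0)
  (dfwith (T := T 0) (fun _ => 0) (i := -1) s).
have [g gh] := nullhomotopic_map h.
have g0 : g 0 = f 0.
  rewrite gh /h dfwith_out // comp0m add0r f0 dfwith_in; congr (_ \c _).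
  exact: (dfwith_in (T := T 0) (fun _ => 0)).
have down (i : int) : i + 1 < 0 -> i < 0 by lia.
have fg0 (i : int) : ~~ (i < 0) -> (f - g) i = 0.
  rewrite -leNgt le_eqVlt => /orP[/eqP<-|/X0[z _]]; last exact: z.
  by rewrite [LHS](congr1 (fun t => f 0 - t) g0) subrr.
have [k fgk] := cut_factor hO down fg0.
have k0 : kclass k = 0.
  apply: oZ => i; last by rewrite leNgt; exact: (@cut_term0 A O hO (fun i => i < 0) X i).
  by rewrite /= /cut_term; case: ifP.
have : kclass (f - g) = 0.
  by rewrite fgk -kclass_comp k0; exact: (@comp0m (Kminus A)).
have /eqP : kclass g = 0 by apply/kclass_eq0; exists h.
by rewrite kclassB => /eqP->; rewrite subr0.
Qed.

End Orthogonality.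

Section Extension.
Variables (A : preadditive) (S : A -> Prop).
Variables (O : A) (hO : is_zero O) (SO : S O).
Variables (X Z : bcomplex A).
Hypothesis SX : T_C S X.
Hypothesis X0 : forall i : int, 0 < i -> is_zero (X i).
Hypothesis oZ : orthogonal S Z.

(* The map [y d] from the shifted truncation of [X] in degrees [< 0] to [Z] is
   null homotopic by [orthogonal_faithful]; the homotopy is the extension of [y]. *)
Lemma orthogonal_extend (y : hom (X 0) (Z 0)) (s : hom (X (-1)) (Z (-1))) :
  diff Z 0 1 \c y = 0 -> y \c diff X (-1) 0 = diff Z (-1) 0 \c s ->
  exists g : chain_map X Z, g 0 = y.
Proof.
move=> dy yd.
have down (i : int) : i + 1 <= 0 -> i <= 0 by lia.
(* [W] has the term X^(i-1) in each degree i <= 0, so X^(-1) sits in degree 0 and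
   [orthogonal_faithful] applies with [W] as source. *)
pose W := cut hO down (unshift X).
have W0 (i : int) : 0 < i -> is_zero (W i).
  by rewrite ltNge; exact: (@cut_term0 A O hO (fun i => i <= 0) (unshift X) i).
pose in_ := cut_in O (fun i : int => i <= 0) (unshift X).
pose pr_ := cut_pr O (fun i : int => i <= 0) (unshift X).
have Wd (i j : int) : diff W i j = pr_ j \c diff (unshift X) i j \c in_ i by [].
have inpr (i : int) : i <= 0 -> in_ i \c pr_ i = idm _ by move=> i0; rewrite cut_inK.
pose F := dfwith (T := fun i => hom (W i) (Z i)) (fun _ => 0) (i := 0)
  (y \c diff X (-1) 0 \c in_ 0).
have F0 : F 0 = y \c diff X (-1) 0 \c in_ 0 by rewrite /F dfwith_in.
have Fn (i : int) : i != 0 -> F i = 0 by move=> i0; rewrite /F dfwith_out // eq_sym.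
have FP (i j : int) : F j \c diff W i j = diff Z i j \c F i.
  have [ji|ji] := eqVneq j (i + 1); last by rewrite !diff_shape // comp0m compm0.
  have [j0|j0] := eqVneq j 0; last first.
    rewrite [F j]Fn // comp0m; have [i0|i0] := eqVneq i 0; last by rewrite Fn // compm0.
    by rewrite ji i0 F0 !compA; have -> : diff Z 0 (0 + 1) \c y = 0 := dy; rewrite !comp0m.
  rewrite (Fn i); last by lia.
  have in_d : in_ 0 \c diff W i 0 = diff (unshift X) i 0 \c in_ i.
    by rewrite Wd !compA inpr // comp1m.
  have dd : diff X (-1) 0 \c diff (unshift X) i 0 = 0.
    exact: (etrans (compmN _ _) (etrans (congr1 -%R (diffK X _ _ _)) (oppr0 _))).
  rewrite compm0 j0 F0 -!compA.
  refine (etrans (congr1 (fun t => y \c (diff X (-1) 0 \c t)) in_d) _).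
  by rewrite [X in y \c X]compA [X in y \c (X \c _)]dd comp0m compm0.
pose f : chain_map W Z := @ChainMap _ W Z _ FP.
have f0 : f 0 = diff Z (-1) 0 \c (s \c in_ 0) by rewrite [LHS]F0 yd compA.
have [h hf] : exists h, nullhomotopy f h.
  apply/kclass_eq0; apply: (orthogonal_faithful hO SO _ W0 oZ f0) => i.
  by rewrite /= /cut_term; case: ifP.
(* [a] is the projection from X^i to W^(i+1); it anticommutes with d because of the sign in
   [unshift]. *)
pose a (i : int) : hom (X i) (W (i + 1)) := pr_ (i + 1) \c transport X (esym (addrK 1 i)).
pose g := dfwith (T := fun i => hom (X i) (Z i)) (fun i => h (i + 1) i \c a i) y.
have g0 : g 0 = y by rewrite /g dfwith_in.
have gn (i : int) : i != 0 -> g i = h (i + 1) i \c a i.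
  by move=> i0; rewrite /g dfwith_out // eq_sym.
have da (i j : int) : diff W (i + 1) (j + 1) \c a i = - (a j \c diff X i j).
  rewrite /a compA -(cut_prP hO down (unshift X)).
  refine (etrans (congr1 (fun t => t \c _) (compmN _ _)) _).
  rewrite compNm -!compA; congr (- (_ \c _)).
  exact: (diff_transport X (esym (addrK 1 i)) (esym (addrK 1 j))).
have hfa (i : int) : f (i + 1) \c a i =
    diff Z i (i + 1) \c (h (i + 1) i \c a i)
    - h (i + 1 + 1) (i + 1) \c a (i + 1) \c diff X i (i + 1).
  rewrite hf addrK compDl [LHS]addrC; congr (_ + _); first by rewrite compA.
  by rewrite -[LHS]compA da compmN compA.
have gP (i j : int) : g j \c diff X i j = diff Z i j \c g i.
  have [ji|ji] := eqVneq j (i + 1); last by rewrite !diff_shape // comp0m compm0.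
  have [i_gt0|i_le0] := ltrP 0 i; first by have [z _] := X0 i_gt0; rewrite [LHS]z [RHS]z.
  have [i0|i_neq0] := eqVneq i 0.
    rewrite ji i0 g0; have -> : diff Z 0 (0 + 1) \c y = 0 := dy.
    have [_ z] : is_zero (X (0 + 1)) by exact: X0.
    by rewrite [diff X _ _]z compm0.
  (* Below degree 0 the chain map equation is the homotopy equation [hfa]: its left side vanishes
     for j <> 0 and is y d for j = 0. *)
  rewrite (gn i) //; have [j0|j0] := eqVneq j 0; last first.
    subst j; rewrite gn //; have := hfa i.
    have -> : f (i + 1) = 0 by exact: Fn.
    by rewrite comp0m => /esym/eqP; rewrite subr_eq0 => /eqP.
  have i1 : i = -1 by lia.
  rewrite {}i1 {}j0 g0 in i_neq0 *.
  have ina : in_ 0 \c a (-1) = idm (X (-1)).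
    refine (etrans (compA _ _ _) _).
    refine (etrans (congr1 (fun t => t \c _) (inpr 0 isT)) (etrans (comp1m _) _)).
    exact: (transport1 X (i := -1)).
  have fa : f 0 \c a (-1) = y \c diff X (-1) 0.
    have -> : f 0 = y \c diff X (-1) 0 \c in_ 0 := F0.
    by rewrite -[LHS]compA; refine (etrans (congr1 (fun t => _ \c t) ina) (compm1 _)).
  have a0 : a (-1 + 1) = 0.
    have [_ z] : is_zero (W (-1 + 1 + 1)) by exact: (W0 1).
    exact: z.
  have := hfa (-1); rewrite a0 compm0 comp0m subr0 => e.
  exact: etrans (esym fa) e.
by exists (@ChainMap _ X Z _ gP).
Qed.

End Extension.

(** * Exactness and orthogonality in H_A *)

Section Abelian.
Variables (A : preadditive) (abA : abelian_cat A).

Lemma kernel_mono (K X Y : A) (k : hom K X) (f : hom X Y) : is_kernel k f -> mono k.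
Proof.
case=> fk ku W g h kgh; have fkh : f \c (k \c h) = 0 by rewrite compA fk comp0m.
by have [u [_ uu]] := ku _ _ fkh; rewrite -(uu g) // -(uu h).
Qed.

Lemma mono_eq0 (X Y W : A) (k : hom X Y) (g : hom W X) : mono k -> k \c g = 0 -> g = 0.
Proof. by move=> mk kg; apply: mk; rewrite kg compm0. Qed.

(** The cokernel of [c] is a cohomology object of [X], hence zero, and [g] factors through it. *)
Lemma no_cohomology_bound (X : bcomplex A) i K (k : hom K (X i)) c :
  no_cohomology X i -> is_kernel k (diff X i (i + 1)) -> k \c c = diff X (i - 1) i ->
  forall Z (g : hom K Z), g \c c = 0 -> g = 0.
Proof.
move=> nX kk kc Z g gc; have [_ _ cokA _ _] := abA.
have [Q [q qc]] := cokA _ _ c.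
have [/= z _] := nX (Cohomology kk kc qc).
by have [u [<- _]] := qc.2 _ _ gc; rewrite (z _ u) comp0m.
Qed.

(** Applied to the inclusion of the cycles, the hypothesis yields a section of the boundary map, so
    the projection to cohomology is zero. *)
Lemma exact_no_cohomology (X : bcomplex A) (i : int) :
  (forall M (g : hom M (X i)), diff X i (i + 1) \c g = 0 ->
     exists h, g = diff X (i - 1) i \c h) -> no_cohomology X i.
Proof.
move=> eX H; have [h hE] := eX _ _ (coh_inclP H).1.
have bh : coh_bound H \c h = idm _.
  apply: (kernel_mono (coh_inclP H)).
  by rewrite compA coh_boundP -hE compm1.
have p0 : coh_proj H = 0 by rewrite -[LHS]compm1 -bh compA (coh_projP H).1 comp0m.
apply/is_zeroP; have e0 : (0 : hom _ (coh_obj H)) \c coh_bound H = 0 by rewrite comp0m.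
have [u [_ uu]] := (coh_projP H).2 _ _ e0.
by rewrite -(uu (idm _)) ?comp1m // (uu 0) // comp0m.
Qed.

Section HeartA.
Variable X : bcomplex A.
Hypothesis hX : heartA_pred (X : Kminus A).

(** As X^(-3) is zero, the kernel of the differential is H^(-2), which vanishes. *)
Lemma heartA_mono : mono (diff X (-2) (-1)).
Proof.
have [X0 nX] := hX; have [_ kerA _ _ _] := abA.
have [K [k kk]] := kerA _ _ (diff X (-2) (-2 + 1)).
have [z _] : is_zero (X (-2 - 1)) by exact: X0.
have kc : k \c 0 = diff X (-2 - 1) (-2) by rewrite [RHS]z [LHS]z.
have K0 : idm K = 0.
  by apply: (no_cohomology_bound (nX (-2) isT) kk kc); exact: compm0.
move=> W g h gh; apply/eqP; rewrite -subr_eq0; apply/eqP.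
have e : diff X (-2) (-2 + 1) \c (g - h) = 0.
  by rewrite compDr compmN [X in X - _]gh subrr.
by have [u [<- _]] := kk.2 _ _ e; rewrite -[u]comp1m K0 comp0m compm0.
Qed.

(** The map [c] from X^(-2) to the cycles of degree -1 is mono, hence the kernel of some [q]. Since
    H^(-1) vanishes, q c = 0 forces q = 0, and every map into the cycles factors through [c]. *)
Lemma heartA_exact M (g : hom M (X (-1))) : diff X (-1) 0 \c g = 0 ->
  exists h, g = diff X (-2) (-1) \c h.
Proof.
move=> dg; have [X0 nX] := hX; have [_ kerA _ monoA _] := abA.
have [K [k kk]] := kerA _ _ (diff X (-1) (-1 + 1)).
have [c [kc _]] := kk.2 _ _ (diffK X (-1 - 1) (-1) (-1 + 1)).
have mc : mono c.
  move=> W u v cuv; apply: heartA_mono.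
  have -> : diff X (-2) (-1) = k \c c by exact: esym.
  by rewrite -!compA cuv.
have [Z [q cq]] := monoA _ _ _ mc.
have q0 := no_cohomology_bound (nX (-1) isT) kk kc cq.1.
have [u [uE _]] := kk.2 _ _ dg.
have [v [vE _]] : exists! v, c \c v = u by apply: cq.2; rewrite q0 comp0m.
exists v; rewrite -uE -vE compA; exact: (congr1 (fun t => t \c v)).
Qed.

(** Only degrees -1 and -2 matter. Since Y^0 is zero, [f (-1)] is a cycle and lifts to X^(-2); this
    lift is the whole homotopy, and injectivity of the differential settles degree -2. *)
Lemma heartA_orthogonal (S : A -> Prop) : orthogonal S X.
Proof.
move=> Y _ Y0 f; rewrite -[f]kreprK; move: (krepr f) => {}f.
apply/kclass_eq0; have [X0 _] := hX.
have df : diff X (-1) 0 \c f (-1) = 0.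
  by have [z _] := Y0 0 isT; rewrite -cmapP (z _ (f 0)) comp0m.
have [s fs] := heartA_exact df.
pose T i j := hom (Y i) (X j).
pose h := dfwith (T := fun i => forall j, T i j) (fun _ _ => 0) (i := -1)
  (dfwith (T := T (-1)) (fun _ => 0) (i := -2) s).
have hE : h (-1) (-2) = s.
  by rewrite /h dfwith_in (dfwith_in (T := T (-1)) (fun _ => 0)).
have h0 i j : i != -1 -> h i j = 0 by move=> i1; rewrite /h dfwith_out // eq_sym.
exists h => i.
have [i_ge0|] := lerP 0 i; first by have [z _] := Y0 i i_ge0; rewrite [LHS]z [RHS]z.
have [-> _|i1] := eqVneq i (-1).
  rewrite (h0 (-1 + 1)) // comp0m add0r fs.
  exact: (congr1 (fun t => diff X (-2) (-1) \c t) (esym hE)).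
have [-> _|i2 i_lt0] := eqVneq i (-2); last first.
  have [_ z] : is_zero (X i) by apply: X0; lia.
  by rewrite [LHS]z [RHS]z.
have [_ z] : is_zero (X (-2 - 1)) by exact: X0.
rewrite (h0 (-2)) // compm0 addr0; apply: heartA_mono.
rewrite -cmapP fs -compA; congr (_ \c _).
exact: (congr1 (fun t => t \c diff Y (-2) (-1)) (esym hE)).
Qed.

End HeartA.

End Abelian.

Section Presentations.
Variables (A : preadditive) (abA : abelian_cat A).
Local Notation K := (Kminus A).
Local Notation P := (stalk0 abA).
Local Notation Pm := (Pmap abA).

(* [x] exhibits [X] as the cokernel of [r : P M1 -> P M0], both for the maps from
   stalk complexes and for the maps to orthogonal objects. *)
Definition presents (S : A -> Prop) (X : K) (M1 M0 : A) (r : hom M1 M0)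
    (x : hom (P M0) X) : Prop :=
  [/\ x \c Pm r = 0,
      forall M (y : hom (P M) X), exists f, y = x \c Pm f,
      forall M (f : hom M M0), x \c Pm f = 0 -> exists g, f = r \c g,
      forall (Z : K) (g g' : hom X Z), orthogonal S Z -> g \c x = g' \c x -> g = g'
    & forall (Z : K) (y : hom (P M0) Z), orthogonal S Z -> y \c Pm r = 0 ->
        exists g : hom X Z, g \c x = y].

Lemma iso_presents S (X Y : K) M1 M0 (r : hom M1 M0) (x : hom (P M0) X)
    (u : hom X Y) :
  is_iso u -> presents S r x -> presents S r (u \c x).
Proof.
move=> [v [vu uv]] [xr xs xk xe xx]; split.
- by rewrite -compA xr compm0.
- move=> M y; have [f yf] := xs M (v \c y); exists f.
  by rewrite -compA -yf compA uv comp1m.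
- move=> M f; rewrite -compA => uxf; apply: xk.
  by rewrite -[LHS]comp1m -vu -compA uxf compm0.
- move=> Z g g' oZ; rewrite !compA => /(xe Z _ _ oZ) e.
  by rewrite -[g]compm1 -[g']compm1 -uv !compA e.
- move=> Z y oZ /(xx Z y oZ)[g gx]; exists (g \c v).
  by rewrite -compA (compA v) vu comp1m.
Qed.

(** The map [x] is the identity of X^0. The conditions on maps from stalks come from
    [stalk_map_nullP], those on maps to orthogonal objects from [orthogonal_faithful] and
    [orthogonal_extend]. *)
Lemma complex_presents S (X : bcomplex A) : S (zero_obj abA) -> T_C S X ->
  (forall i : int, 0 < i -> is_zero (X i)) ->
  exists x : hom (P (X 0)) (X : K), presents S (diff X (-1) 0) x.
Proof.
move=> S0 SX X0; have O0 := zero_objP abA.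
have dX M (y : hom M (X 0)) : diff X 0 1 \c y = 0.
  by have [_ z] := X0 1 isT; rewrite (z _ (diff X 0 1)) comp0m.
have xP M (f : hom M (X 0)) :
    (kclass (stalk_map abA (dX _ (idm _))) : @hom K _ X) \c Pm f
    = kclass (stalk_map abA (dX _ f)).
  rewrite (stalk_map_comp abA _ (dX _ (idm _ \c f))).
  by refine (congr1 (@kclass A _ _) (stalk_map_ext _)); rewrite !stalk_mapE comp1m.
exists (kclass (stalk_map abA (dX _ (idm _)))); split.
- rewrite xP; apply/stalk_map_nullP; exists (idm _).
  by rewrite stalk_mapE compm1.
- move=> M y; have [f [hf ->]] := stalk_homP y; exists f; rewrite xP.
  by refine (congr1 (@kclass A _ _) (stalk_map_ext _)); rewrite !stalk_mapE.
- by move=> M f; rewrite xP => /stalk_map_nullP[s]; rewrite stalk_mapE; exists s.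
- move=> Z g g' oZ e; apply/eqP; rewrite -subr_eq0; apply/eqP.
  have : (g - g') \c (kclass (stalk_map abA (dX _ (idm _))) : @hom K _ X) = 0.
    by rewrite compDl compNm e subrr.
  rewrite -[g - g']kreprK [LHS]kclass_comp => /stalk_map_nullP[s].
  rewrite [LHS](congr1 (comp _) (stalk_mapE _ _)) compm1.
  refine (orthogonal_faithful O0 S0 SX X0 oZ (f := _) (s := _)).
- move=> Z y oZ; have [f [hf ->]] := stalk_homP y.
  have hfd : diff Z 0 1 \c (f \c diff X (-1) 0) = 0 by rewrite compA hf comp0m.
  rewrite (stalk_map_comp abA hf hfd) => /stalk_map_nullP[s].
  rewrite stalk_mapE => fd.
  have [g g0] := orthogonal_extend O0 S0 SX X0 oZ hf fd.
  exists (kclass g); rewrite [LHS]kclass_comp.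
  refine (congr1 (@kclass A _ _) (stalk_map_ext _)); rewrite stalk_mapE.
  by rewrite [LHS](congr1 (comp _) (stalk_mapE _ _)) compm1.
Qed.

Section CokernelComplex.
Variables (M1 M0 M2 : A) (f : hom M1 M0) (k : hom M2 M1).
Hypothesis kf : is_kernel k f.

(** The complex M2 -> M1 -> M0 in degrees -2, -1, 0, since [Negz n] is -(n + 1); matching on
    constructors lets the terms compute. *)
Definition coker_term (i : int) : A :=
  match i with Posz 0 => M0 | Negz 0 => M1 | Negz 1 => M2 | _ => zero_obj abA end.

Definition coker_diff (i j : int) : hom (coker_term i) (coker_term j) :=
  match i, j return hom (coker_term i) (coker_term j) with
  | Negz 0, Posz 0 => f
  | Negz 1, Negz 0 => k
  | _, _ => 0
  end.

Lemma coker_shape (i j : int) : j != i + 1 -> coker_diff i j = 0.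
Proof. by case: i => [[|[|i]]|[|[|i]]]; case: j => [[|j]|[|[|j]]]. Qed.

Lemma coker_diffK (i j l : int) : coker_diff j l \c coker_diff i j = 0.
Proof.
case: i => [[|[|i]]|[|[|i]]]; case: j => [[|j]|[|[|j]]] /=;
  rewrite ?compm0 ?comp0m //.
by case: l => [[|l]|l] /=; rewrite ?comp0m // kf.1.
Qed.

Lemma coker_term0 (i : int) : (i < - 2%:Z) || (0 < i) -> is_zero (coker_term i).
Proof. by case: i => [[|[|i]]|[|[|i]]] //= _; exact: zero_objP. Qed.

Lemma coker_bounded : exists n : int, forall i, n < i -> is_zero (coker_term i).
Proof. by exists 0 => i i0; apply: coker_term0; rewrite i0 orbT. Qed.

Definition coker_complex : bcomplex A := BComplex coker_shape coker_diffK coker_bounded.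

Lemma coker_heartA : heartA_pred (coker_complex : K).
Proof.
split=> [|i i_lt0]; first exact: coker_term0.
apply: exact_no_cohomology => M.
case: i i_lt0 => [[|[|i]]|[|[|i]]] // _ g.
- by move=> /kf.2[h [<- _]]; exists h.
- move=> kg; exists 0; rewrite compm0.
  exact: mono_eq0 (kernel_mono kf) kg.
- move=> _; exists 0; rewrite compm0.
  by have [_ z] := zero_objP abA; exact: z.
Qed.

End CokernelComplex.

(** Kernels in A complete [f] to a complex of H_A. Cokernels are thus formed in H_A first and
    carried to the other heart by approximation. *)
Lemma cokernel_heartA M1 M0 (f : hom M1 M0) :
  exists (W : K) (w : hom (P M0) W),
    heartA_pred W /\ presents (fun _ => True) f w.
Proof.
have [_ kerA _ _ _] := abA; have [M2 [k kf]] := kerA _ _ f.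
have W0 (i : int) : 0 < i -> is_zero (coker_complex kf i).
  by move=> i0; apply: coker_term0; rewrite i0 orbT.
have [x px] := @complex_presents (fun _ => True) (coker_complex kf) I (fun=> I) W0.
by exists (coker_complex kf), x; split=> //; exact: coker_heartA.
Qed.

End Presentations.
(** * Approximations of objects of H_A *)

Section IdempotentSplitting.
Variables (A : preadditive) (abA : abelian_cat A).

Lemma idempotent_split (M : A) (e : hom M M) : e \c e = e ->
  exists (Z : A) (i : hom Z M) (p : hom M Z), p \c i = idm Z /\ i \c p = e.
Proof.
move=> ee; have [_ kerA _ _ _] := abA; have [Z [i ki]] := kerA _ _ (idm M - e).
have e0 : (idm M - e) \c e = 0 by rewrite compDl compNm comp1m ee subrr.
have [p [ip _]] := ki.2 _ _ e0; exists Z, i, p; split=> //.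
apply: (kernel_mono ki); rewrite compA ip compm1.
by have := ki.1; rewrite compDl compNm comp1m => /eqP; rewrite subr_eq0 => /eqP.
Qed.

(** The complement is obtained by splitting the idempotent 1 - i p. *)
Lemma retract_biproduct (M Z : A) (i : hom Z M) (p : hom M Z) : p \c i = idm Z ->
  exists Z' (i' : hom Z' M) (p' : hom M Z'),
    [/\ p' \c i' = idm Z', p \c i' = 0, p' \c i = 0 & i \c p + i' \c p' = idm M].
Proof.
move=> pi; pose e := idm M - i \c p.
have ei : e \c i = 0 by rewrite compDl compNm comp1m -compA pi compm1 subrr.
have pe : p \c e = 0 by rewrite compDr compmN compm1 compA pi comp1m subrr.
have ee : e \c e = e by rewrite {2}/e compDr compmN compm1 compA ei comp0m subr0.
have [Z' [i' [p' [p'i' i'p']]]] := idempotent_split ee.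
exists Z', i', p'; split=> //; last by rewrite i'p' /e addrC subrK.
- by rewrite -[i']compm1 -p'i' !compA -(compA p) i'p' pe comp0m.
- by rewrite -[p']comp1m -p'i' -!compA (compA i') i'p' ei compm0.
Qed.

Lemma karoubi_retract (C : A -> Prop) (M Z : A) (i : hom Z M) (p : hom M Z) :
  karoubi_closed C -> p \c i = idm Z -> C M -> C Z.
Proof.
move=> karC pi; have [Z' [i' [p' [e1 e2 e3 e4]]]] := retract_biproduct pi.
by apply: (karC M Z Z'); exists i, i', p, p'.
Qed.

End IdempotentSplitting.

Section HomotopySplitting.
Variables (A : preadditive) (X : bcomplex A) (g : chain_map X X).
Variables (Y : int -> A) (a : forall i, hom (X i) (Y i)) (b : forall i, hom (Y i) (X i)).
Hypothesis ab : forall i, a i \c b i = idm (Y i).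
Hypothesis ba : forall i, b i \c a i = g i.

Lemma hsplit_shape (i j : int) : j != i + 1 -> a j \c diff X i j \c b i = 0.
Proof. by move=> ij; rewrite diff_shape // compm0 comp0m. Qed.

Lemma hsplit_aP (i j : int) : a j \c diff X i j = a j \c diff X i j \c b i \c a i.
Proof. by rewrite -[RHS]compA ba -compA -cmapP -ba !compA ab comp1m. Qed.

Lemma hsplit_bP (i j : int) : b j \c (a j \c diff X i j \c b i) = diff X i j \c b i.
Proof. by rewrite !compA ba cmapP -ba -!compA ab compm1. Qed.

Lemma hsplit_diffK (i j k : int) :
  (a k \c diff X j k \c b j) \c (a j \c diff X i j \c b i) = 0.
Proof. by rewrite -(compA _ (b j)) hsplit_bP -!compA (compA (diff _ _ _)) diffK comp0m compm0. Qed.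

Lemma hsplit_bounded : exists n : int, forall i, n < i -> is_zero (Y i).
Proof.
by have [n hn] := term_bounded X; exists n => i /hn; exact: is_zero_retract (ab i).
Qed.

Definition hsplit : bcomplex A := BComplex hsplit_shape hsplit_diffK hsplit_bounded.

(** The maps [a] and [b] form chain maps with a b = 1 and b a = g exactly, and [g] is homotopic to
    the identity. *)
Lemma hsplit_iso s : nullhomotopy (g - cmap_id X) s ->
  @isomorphic (Kminus A) X hsplit.
Proof.
move=> gs; pose u := @ChainMap _ X hsplit a hsplit_aP.
pose v := @ChainMap _ hsplit X b hsplit_bP.
exists (kclass u), (kclass v); split; rewrite [LHS]kclass_comp.
  transitivity (kclass g); last by apply/kclass_eq; exists s.
  by refine (congr1 (@kclass A _ _) (cmap_ext _)) => i; exact: ba.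
by refine (congr1 (@kclass A _ _) (cmap_ext _)) => i; exact: ab.
Qed.

End HomotopySplitting.

Section Truncation.
Variables (A : preadditive) (abA : abelian_cat A) (C : A -> Prop).
Hypotheses (karC : karoubi_closed C) (C0 : C (zero_obj abA)).
Variable X : bcomplex A.
Hypothesis CX : T_C C X.
Hypothesis exX : forall M, C M -> forall (i : int) (f : hom M (X i)), 0 < i ->
  diff X i (i + 1) \c f = 0 -> exists g, f = diff X (i - 1) i \c g.

(** Descending induction from the bound [n]. If d t d = d in degree j + 1, then 1 - t d consists of
    cycles and equals d u by exactness; composing with d gives d u d = d in degree j. *)
Lemma diff_regular (j : int) : 0 <= j ->
  exists t, diff X j (j + 1) \c t \c diff X j (j + 1) = diff X j (j + 1).
Proof.
have [n hn] := term_bounded X.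
suff H (k : nat) : forall j : int, 0 <= j -> n - k%:Z <= j ->
    exists t, diff X j (j + 1) \c t \c diff X j (j + 1) = diff X j (j + 1).
  by move=> j0; apply: (H (absz (n - j)) j) => //; lia.
elim: k => [|k IHk] {}j j0 nj.
  by exists 0; have [_ z] := hn (j + 1) ltac:(lia); rewrite [LHS]z [RHS]z.
have [t dtd] := IHk (j + 1) ltac:(lia) ltac:(lia).
pose e := idm _ - t \c diff X (j + 1) (j + 1 + 1).
have de : diff X (j + 1) (j + 1 + 1) \c e = 0.
  by rewrite compDr compmN compm1 compA dtd subrr.
have j1 : 0 < j + 1 by lia.
have := exX (CX (j + 1)) j1 de; rewrite addrK => -[u eu]; exists u.
by rewrite -eu compDl compNm comp1m -compA diffK compm0 subr0.
Qed.

(* If [d t d = d] in all degrees [>= 0], then [t (1 - t d)] contracts [X] in the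
   positive degrees and [1 - t d] is an idempotent in degree [0]. *)
Lemma exact_le0 : T_C_le0 C (X : Kminus A).
Proof.
split=> //.
(* A map is chosen for every pair of degrees, so that no cast arises. It is zero from source degrees
   <= 0, which leaves the negative part of [X] untouched. *)
have tex (ij : int * int) : exists t : hom (X ij.1) (X ij.2),
    (ij.1 <= 0 -> t = 0) /\ (ij.1 = ij.2 + 1 -> 0 < ij.1 ->
      diff X ij.2 ij.1 \c t \c diff X ij.2 ij.1 = diff X ij.2 ij.1).
  case: ij => i j /=; have [i0|i0] := lerP i 0; first by exists 0; split=> //; lia.
  have [ij|ij] := eqVneq i (j + 1); last by exists 0; split=> [|e]; [lia|rewrite e eqxx in ij].
  subst i; have [t dtd] : exists t, diff X j (j + 1) \c t \c diff X j (j + 1) = diff X j (j + 1).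
    by apply: diff_regular; lia.
  by exists t; split=> //; lia.
pose t i j := projT1 (cid (tex (i, j))).
have t0 i j : i <= 0 -> t i j = 0.
  by rewrite /t; case: (cid _) => /= u [] + _; exact.
have td j : 0 <= j -> diff X j (j + 1) \c t (j + 1) j \c diff X j (j + 1) = diff X j (j + 1).
  move=> j0; rewrite /t; case: (cid _) => /= u [_ uE]; apply: uE => //; lia.
pose e i := idm (X i) - t (i + 1) i \c diff X i (i + 1).
have de (i : int) : 0 <= i -> diff X i (i + 1) \c e i = 0.
  by move=> i0; rewrite compDr compmN compm1 compA td // subrr.
have ed (i : int) : e (i + 1) \c diff X i (i + 1) = diff X i (i + 1).
  by rewrite compDl compNm comp1m -compA diffK compm0 subr0.
have ee (i : int) : 0 <= i -> e i \c e i = e i.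
  by move=> i0; rewrite {1}/e compDl compNm comp1m -compA de // compm0 subr0.
(* The map g = 1 + d h + h d is the identity in negative degrees, the idempotent [e 0] in degree 0
   and zero in positive degrees. *)
pose h i j := - (t i j \c e i).
have [k kh] := nullhomotopic_map h.
have hd (i : int) : h (i + 1) i \c diff X i (i + 1) = - (t (i + 1) i \c diff X i (i + 1)).
  by rewrite compNm -compA ed.
pose g := cmap_id X + k.
have gE (i : int) : g i = idm (X i) + k i by [].
have g_lt0 (i : int) : i < 0 -> g i = idm (X i).
  move=> i0; rewrite gE kh /h !t0; [|lia|lia].
  by rewrite !(comp0m, oppr0, compm0, addr0).
have g_0 : g 0 = e 0.
  rewrite gE kh hd; have -> : h 0 (0 - 1) = 0 by rewrite /h t0 // comp0m oppr0.
  by rewrite compm0 addr0.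
have g_gt0 (i : int) : 0 < i -> g i = 0.
  move=> i0; rewrite gE kh hd addrA; apply/eqP; rewrite addr_eq0; apply/eqP.
  (* The cycle [e i] is a boundary d t', so d t d = d yields d t (e i) = e i, which is the required
     cancellation. *)
  have [t' t'E] : exists u : hom (X i) (X (i - 1)), e i = diff X (i - 1) i \c u.
    by apply: (exX (CX i)) => //; apply: de; exact: ltW.
  have td' : diff X (i - 1) i \c t i (i - 1) \c diff X (i - 1) i = diff X (i - 1) i.
    by have := td (i - 1); rewrite subrK; apply; lia.
  by rewrite -/(e i) /h compmN opprK compA {2}t'E compA td' -t'E.
have Yex (i : int) : exists Y : {Y : A & (hom (X i) Y * hom Y (X i))%type},
    [/\ (projT2 Y).1 \c (projT2 Y).2 = idm _, (projT2 Y).2 \c (projT2 Y).1 = g i,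
        C (projT1 Y) & 0 < i -> is_zero (projT1 Y)].
  have [i0|i0|->] := ltrgtP i 0.
  - exists (existT _ (X i) (idm _, idm _)); split.
    + exact: comp1m.
    + by rewrite g_lt0 //; exact: comp1m.
    + exact: CX.
    + by [].
  - have O0 := zero_objP abA; exists (existT _ (zero_obj abA) (0, 0)); split=> //.
    + by have [z _] := O0; rewrite [LHS]z [RHS]z.
    + by rewrite g_gt0 //; exact: comp0m.
  - have [Z [i' [p [pi ip]]]] := idempotent_split abA (ee 0 (lexx _)).
    exists (existT _ Z (p, i')); split=> //; first by rewrite g_0.
    exact: (karoubi_retract abA karC pi).
pose Y i := projT1 (cid (Yex i)).
pose a i : hom (X i) (projT1 (Y i)) := (projT2 (Y i)).1.
pose b i : hom (projT1 (Y i)) (X i) := (projT2 (Y i)).2.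
have ab (i : int) : a i \c b i = idm _ by rewrite /a /b /Y; case: (cid _) => ? [].
have ba (i : int) : b i \c a i = g i by rewrite /a /b /Y; case: (cid _) => ? [].
exists (hsplit ab ba); split=> [i|i|].
- by rewrite /= /Y; case: (cid _) => ? [].
- by rewrite /= /Y; case: (cid _) => ? [].
- by apply: (@hsplit_iso _ X g _ a b ab ba h); rewrite /g addrAC subrr add0r.
Qed.

End Truncation.

Section Stalks.
Variables (A : preadditive) (O : A) (hO : is_zero O) (M : A) (n : int).

Lemma stalk_at_bounded :
  exists m : int, forall i, m < i -> is_zero (cut_term O (pred1 n) (fun _ => M) i).
Proof. by exists n => i ni; apply: cut_term0 => //; rewrite /= gt_eqF. Qed.

Definition stalk_at : bcomplex A :=
  @BComplex A (cut_term O (pred1 n) (fun _ => M)) (fun _ _ => 0) (fun _ _ _ => erefl)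
    (fun _ _ _ => comp0m _ _) stalk_at_bounded.

Lemma stalk_at_T_C (C : A -> Prop) : C O -> C M -> T_C C stalk_at.
Proof. by move=> CO CM i; rewrite /= /cut_term; case: ifP. Qed.

(** This turns a cycle of degree [n] into a map of complexes, so that exactness of [X] in degree [n]
    can be tested by maps in K^-(A). *)
Lemma stalk_at_map (X : bcomplex A) (f : hom M (X n)) : diff X n (n + 1) \c f = 0 ->
  exists (g : chain_map stalk_at X) (a : hom M (stalk_at n)), g n \c a = f.
Proof.
move=> df; pose F := dfwith (T := fun i => hom M (X i)) (fun _ => 0) f.
pose in_ := cut_in O (pred1 n) (fun _ => M).
have gP (i j : int) : F j \c in_ j \c diff stalk_at i j = diff X i j \c (F i \c in_ i).
  rewrite [LHS]compm0 compA /F; case: dfwithP => [|k _]; last by rewrite compm0 comp0m.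
  have [->|nj] := eqVneq j (n + 1); first by rewrite df comp0m.
  by rewrite diff_shape // !comp0m.
exists (@ChainMap _ stalk_at X _ gP), (cut_pr O (pred1 n) (fun _ => M) n).
by rewrite /= -compA cut_inK /= ?eqxx // compm1 /F dfwith_in.
Qed.

End Stalks.

Section HeartC.
Variables (A : preadditive) (abA : abelian_cat A) (C : A -> Prop).
Hypotheses (addC : additive_cat (full_sub C)) (isoC : strictly_full C).
Hypothesis karC : karoubi_closed C.
Local Notation K := (Kminus A).

Let O0 := zero_objP abA.
Let CO : C (zero_obj abA) := zero_objC abA addC isoC.

(** [Y] is the translate of [unshift Y], which lies in the <= 0 part. *)
Lemma heartC_orthogonal (X : K) : heartC_pred C X -> orthogonal C X.
Proof.
move=> [_ [_ X0]] Y CY Y0 f.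
have [w [w' [_ ww']]] := shift_unshift Y.
have fw : (f : @hom K Y X) \c w = 0.
  apply: X0; split; first by move=> i; exact: CY.
  exists (unshift Y); split; last exact: isomorphic_refl.
    by move=> i; exact: CY.
  by move=> i i0; apply: Y0; lia.
by rewrite -[LHS](@compm1 K) -ww' (@compA K) fw (@comp0m K).
Qed.

Lemma heartC_presents (X : K) : heartC_pred C X ->
  exists M1 M0 (r : hom M1 M0) (x : hom (stalk0 abA M0) X),
    [/\ C M1, C M0 & presents C r x].
Proof.
move=> [[_ [Y [CY Y0 /isomorphic_sym[u iu]]]] _].
have [x px] := complex_presents CO CY Y0.
exists (Y (-1)), (Y 0), (diff Y (-1) 0), (u \c x).
by split; [exact: CY | exact: CY | exact: iso_presents].
Qed.

(** Orthogonality passes from [W] to [V] along the bijection on maps. A cycle M -> V^i with i > 0 is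
    a map from a stalk whose composite to [W] vanishes because W^i is zero; it is thus null
    homotopic, and the homotopy writes the cycle as a boundary. Then [exact_le0] applies. *)
Lemma approximation_heartC (W V : K) : heartA_pred W -> is_approximation C W V ->
  heartC_pred C V /\ exists t : hom V W, forall Y : K, T_C C Y ->
    (forall g : hom Y W, exists g', g = t \c g') /\
    (forall g g' : hom Y V, t \c g = t \c g' -> g = g').
Proof.
move=> hW [CV [t' [_ bt]]]; pose t : @hom K V W := kclass t'.
have tP (Y : K) : T_C C Y -> (forall g : hom Y W, exists g', g = t \c g') /\
    (forall g g' : hom Y V, t \c g = t \c g' -> g = g').
  move=> /bt bY; split; last by move=> g g'; exact: bij_inj bY _ _.
  by case: bY => s st ts g; exists (s g); rewrite [RHS]ts.
split; last by exists t.
split; last first.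
  split=> // Y [CY [Y' [CY' Y'0 YY']]] f.
  have [u [v [vu _]]] := shift_iso YY'.
  have CsY' : T_C C (shift Y' : K) by move=> i; exact: CY'.
  have fv : f \c v = 0.
    apply: (tP _ CsY').2; rewrite (@compm0 K).
    apply: (heartA_orthogonal abA hW CsY') => i i0.
    by apply: Y'0; lia.
  by rewrite -[LHS](@compm1 K) -vu (@compA K) fv (@comp0m K).
apply: (exact_le0 karC CO CV) => M CM i f i0 df.
have [g [a ga]] := stalk_at_map O0 df.
have CS := @stalk_at_T_C _ _ O0 M i _ CO CM.
have : (kclass g : @hom K _ V) = 0.
  apply: (tP _ CS).2; rewrite (@compm0 K) [LHS]kclass_comp.
  apply/kclass_eq0; exists (fun _ _ => 0) => j; rewrite comp0m compm0 addr0.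
  have [->|ji] := eqVneq j i.
    by have [_ z] : is_zero (W i) by apply: hW.1; rewrite i0 orbT.
  have [z _] : is_zero (stalk_at O0 M i j) by exact: cut_term0.
  exact: z.
move=> /kclass_eq0[s gs]; exists (s i (i - 1) \c a).
by rewrite -ga gs [X in X + _]compm0 add0r compA.
Qed.

End HeartC.

(** * Simple objects of the hearts *)

Section Hearts.
Variables (A : preadditive) (abA : abelian_cat A).
Local Notation K := (Kminus A).
Local Notation P := (stalk0 abA).
Local Notation Pm := (Pmap abA).

(* The common properties of [heartA_pred] (with [S] everything) and of
   [heartC_pred C] (with [S := C]). *)
Record heart_like (S : A -> Prop) (H : K -> Prop) : Prop := HeartLike {
  heart_presents : forall X, H X -> exists M1 M0 (r : hom M1 M0) (x : hom (P M0) X),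
    [/\ S M1, S M0 & presents S r x];
  heart_orthogonal : forall X, H X -> orthogonal S X;
  heart_P : forall M, S M -> H (P M);
  heart_approx : forall W, heartA_pred W -> exists V (t : hom V W), H V /\
    forall X, H X -> (forall g : hom X W, exists g', g = t \c g') /\
      (forall g g' : hom X V, t \c g = t \c g' -> g = g');
  heart_retract : forall M Z (i : hom Z M) (p : hom M Z),
    p \c i = idm Z -> S M -> S Z
}.

Variables (S : A -> Prop) (H : K -> Prop).
Hypothesis hH : heart_like S H.

(** The categorical notions are relativized to the predicate [H], so that maps between objects of
    different hearts compose inside K^-(A). *)
Definition epi_in (X Y : K) (e : hom X Y) : Prop :=
  forall Z (g h : hom Y Z), H Z -> g \c e = h \c e -> g = h.

Definition mono_in (X Y : K) (m : hom X Y) : Prop :=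
  forall W (g h : hom W X), H W -> m \c g = m \c h -> g = h.

Definition simple_in (X : K) : Prop :=
  ~ is_zero X /\
  forall Y (m : hom Y X), H Y -> mono_in m -> is_zero Y \/ is_iso m.

Definition surj_in (X Y : K) (e : hom X Y) : Prop :=
  forall M (y : hom (P M) Y), S M -> exists z, y = e \c z.

(** The generator of [Y] lifts along [e], and it determines all maps from [Y] to objects of [H]. *)
Lemma surj_epi (X Y : K) (e : hom X Y) : H Y -> surj_in e -> epi_in e.
Proof.
move=> HY se Z g h HZ ge.
have [M1 [M0 [r [y [_ SM0 [_ _ _ yi _]]]]]] := heart_presents hH HY.
have [z yz] := se M0 y SM0.
by apply: (yi _ _ _ (heart_orthogonal hH HZ)); rewrite yz !compA ge.
Qed.

(* The cokernel of [e] is presented by the map [N1 + M0 -> N0]. *)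
Lemma epi_surj (X Y : K) (e : hom X Y) : H X -> H Y -> epi_in e -> surj_in e.
Proof.
move=> HX HY ee M y _.
have [M1 [M0 [r [x [_ _ [xr xs _ xi _]]]]]] := heart_presents hH HX.
have [N1 [N0 [r' [x' [_ _ [xr' xs' _ _ xx']]]]]] := heart_presents hH HY.
have [f ex] := xs' _ (e \c x).
have [[_ biA] _ _ _ _] := abA.
have [B [i1 [i2 [p1 [p2 [p1i1 p2i2 p1i2 p2i1 ip]]]]]] := biA N1 M0.
pose phi := r' \c p1 + f \c p2.
have phi1 : phi \c i1 = r' by rewrite compDl -!compA p1i1 p2i1 compm0 addr0 compm1.
have phi2 : phi \c i2 = f by rewrite compDl -!compA p1i2 p2i2 compm0 add0r compm1.
have [W [w [hW [wphi _ wk _ _]]]] := cokernel_heartA abA phi.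
have [g gx'] : exists g, g \c x' = w.
  apply: xx'; first exact: heartA_orthogonal.
  by rewrite -phi1 PmapM compA wphi comp0m.
have ge : g \c e = 0.
  apply: (xi _ _ _ (heartA_orthogonal abA hW (S := S))).
  by rewrite comp0m -compA ex compA gx' -phi2 PmapM compA wphi comp0m.
(* The epimorphism [e] is only tested against [H], so [g] is first lifted to the approximation of
   [W]. *)
have [V [t [HV tV]]] := heart_approx hH hW.
have [g' gt] := (tV _ HY).1 g.
have g'0 : g' = 0.
  apply: ee => //; rewrite comp0m; apply: (tV _ HX).2.
  by rewrite compA -gt ge compm0.
(* Since g' = 0, also w = 0, and the presentation of [W] lifts the identity of [N0] through [phi];
   its component in [M0] supplies the preimage of x'. *)
have [k kE] : exists k, idm N0 = phi \c k.
  by apply: wk; rewrite Pmap1 compm1 -gx' gt g'0 compm0 comp0m.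
have x'E : x' = e \c (x \c Pm (p2 \c k)).
  rewrite -[LHS]compm1 -Pmap1 kE compDl PmapD compDr -!compA !PmapM !compA.
  by rewrite xr' !comp0m add0r ex.
have [l ->] := xs' _ y; exists (x \c Pm (p2 \c k) \c Pm l).
by rewrite [in LHS]x'E -!compA.
Qed.

(** The generator of [Y] lifts along [m]; the lift kills the relation [r] because [m] is mono, so it
    descends to an inverse. *)
Lemma mono_surj_iso (X Y : K) (m : hom X Y) :
  H X -> H Y -> mono_in m -> surj_in m -> is_iso m.
Proof.
move=> HX HY mm sm.
have [M1 [M0 [r [y [SM1 SM0 [yr _ _ yi yx]]]]]] := heart_presents hH HY.
have [z yz] := sm _ y SM0.
have zr : z \c Pm r = 0.
  by apply: mm; [exact: heart_P hH _ SM1 | rewrite compA -yz yr compm0].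
have [u uy] := yx _ _ (heart_orthogonal hH HX) zr.
have mu : m \c u = idm Y.
  by apply: (yi _ _ _ (heart_orthogonal hH HY)); rewrite -compA uy comp1m.
exists u; split=> //.
by apply: mm => //; rewrite compA mu comp1m compm1.
Qed.

(** The universal property of the quotient [p], with its kernel tested on objects of [S]. With x = p
    a and p = x b, the map q a descends to [u], and 1 - a b is killed by [p], hence by [q]. *)
Lemma factor_through (M : A) (L Z : K) (p : hom (P M) L) (q : hom (P M) Z) :
  S M -> H L -> orthogonal S Z -> surj_in p ->
  (forall N (f : hom N M), S N -> p \c Pm f = 0 -> q \c Pm f = 0) ->
  exists u, u \c p = q.
Proof.
move=> SM HL oZ sp pq.
have [N1 [N0 [r [x [SN1 SN0 [xr xs _ _ xx]]]]]] := heart_presents hH HL.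
have [z] := sp _ x SN0; have [a ->] := Pmap_full z => xE.
have [|u ux] := xx _ (q \c Pm a) oZ.
  by rewrite -compA -PmapM pq // PmapM compA -xE.
have [b pE] := xs _ p; exists u.
have : q \c Pm (idm M - a \c b) = 0.
  by apply: pq => //; rewrite PmapB PmapM compDr compmN compA -xE -pE Pmap1 compm1 subrr.
rewrite PmapB PmapM compDr compmN Pmap1 compm1 compA -ux -compA -pE => /eqP.
by rewrite subr_eq0 => /eqP.
Qed.

Lemma nonzero_generator (X : K) : H X -> ~ is_zero X ->
  exists M (y : hom (P M) X), [/\ S M, y <> 0 &
    forall N (z : hom (P N) X), exists f, z = y \c Pm f].
Proof.
move=> HX nX; have [M1 [M0 [r [x [_ SM0 [_ xs _ xi _]]]]]] := heart_presents hH HX.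
exists M0, x; split=> // x0; apply: nX; apply/is_zeroP.
by apply: (xi _ _ _ (heart_orthogonal hH HX)); rewrite x0 !compm0.
Qed.

(* The image of [q], that is the cokernel of its kernel, is a nonzero
   subobject of [L]. *)
Lemma simple_surj (M : A) (L : K) (q : hom (P M) L) :
  H L -> simple_in L -> S M -> q <> 0 -> surj_in q.
Proof.
move=> HL [_ sL] SM q0.
have [N1 [N0 [r [l [_ _ [lr ls lk _ _]]]]]] := heart_presents hH HL.
have [f qf] := ls _ q.
have [[_ biA] kerA _ _ _] := abA.
have [B [i1 [i2 [p1 [p2 [p1i1 p2i2 p1i2 p2i1 ip]]]]]] := biA M N1.
(* [Q] is the pullback of [f] and [r]; by [kapP] its projection [kap] to [M] generates the kernel of
   [q]. *)
have [Q [k [fk kk]]] := kerA _ _ (f \c p1 - r \c p2).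
pose kap := p1 \c k.
have fkap : f \c kap = r \c (p2 \c k).
  by move: fk; rewrite compDl compNm -!compA => /eqP; rewrite subr_eq0 => /eqP.
have kapP N (a : hom N M) : q \c Pm a = 0 <-> exists b, a = kap \c b.
  split=> [|[b ->]]; last first.
    by rewrite PmapM compA qf -(compA l) -PmapM fkap PmapM !compA lr !comp0m.
  rewrite qf -compA -PmapM => /lk[j faj].
  have [|b [bE _]] := kk _ (i1 \c a + i2 \c j).
    rewrite compDl compNm !compDr -!compA !(compA p1) !(compA p2).
    by rewrite p1i1 p2i2 p1i2 p2i1 !comp0m !comp1m !compm0 addr0 add0r faj subrr.
  exists b; rewrite -compA bE compDr !compA p1i1 p1i2.
  by rewrite comp1m comp0m addr0.
have [I [e [hI [ekap es ek _ _]]]] := cokernel_heartA abA kap.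
(* The cokernel lies in H_A. Its approximation [V] lies in [H] and receives the same maps from [P N]
   for N in [S]. *)
have [V [t [HV tV]]] := heart_approx hH hI.
have tP N (SN : S N) := tV _ (heart_P hH SN).
have [e' eE] := (tP _ SM).1 e.
have e'P N (a : hom N M) : S N -> e' \c Pm a = 0 <-> q \c Pm a = 0.
  move=> SN; rewrite kapP; split=> [ea|[b ->]].
    by apply: ek; rewrite eE -compA ea compm0.
  apply: (tP _ SN).2; rewrite compm0 PmapM !compA -eE ekap comp0m //.
have se' : surj_in e'.
  move=> N h SN; have [a aE] := es _ (t \c h); exists (Pm a).
  by apply: (tP _ SN).2; rewrite aE compA -eE.
have [m mE] : exists m, m \c e' = q.
  apply: factor_through => //; first exact: heart_orthogonal hH _ HL.
  by move=> N a SN /(e'P _ _ SN).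
(* A difference of maps equalized by [m] lifts along e' on a generator; the lift is killed by [q],
   hence by e'. *)
have mm : mono_in m.
  move=> W g h HW mgh; apply/eqP; rewrite -subr_eq0; apply/eqP.
  have [O1 [O0 [s [x [_ SO0 [_ _ _ xi _]]]]]] := heart_presents hH HW.
  apply: (xi _ _ _ (heart_orthogonal hH HV)); rewrite comp0m.
  have [z] := se' _ ((g - h) \c x) SO0; have [a ->] := Pmap_full z => zE.
  rewrite zE; apply/e'P => //; rewrite -mE -compA -zE compA.
  by rewrite compDr compmN mgh subrr comp0m.
have [V0|[m' [m'm mm']]] := sL _ _ HV mm.
  by case: q0; rewrite -mE; have [_ z] := V0; rewrite (z _ e') compm0.
move=> N h SN; have [z zE] := se' _ (m' \c h) SN.
by exists z; rewrite -mE -compA -zE compA mm' comp1m.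
Qed.

(** By simplicity p f is surjective, so p = p f k and [p] kills 1 - f k. That map is not invertible,
    as [p] is nonzero, so locality makes f k invertible. *)
Lemma simple_split_epi (M Z : A) (L : K) (p : hom (P Z) L) (f : hom M Z) :
  H L -> simple_in L -> S M -> S Z -> local_end Z ->
  p \c Pm f <> 0 -> exists h, f \c h = idm Z.
Proof.
move=> HL sL SM SZ [_ lZ] pf0.
have [z] := simple_surj HL sL SM pf0 p SZ; have [k ->] := Pmap_full z => pE.
have pk : p \c Pm (idm Z - f \c k) = 0.
  by rewrite PmapB Pmap1 PmapM compDr compmN compm1 compA -pE subrr.
have : is_iso ((idm Z - f \c k) + f \c k).
  by rewrite subrK; exists (idm Z); rewrite comp1m.
case/lZ=> [] [u [_ uE]]; last by exists (k \c u); rewrite compA.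
case: pf0; rewrite -[p]compm1 -Pmap1 -uE PmapM compA pk.
by rewrite !comp0m.
Qed.

(** By [simple_split_epi] both maps kill exactly the non-split maps to [Z], so each factors through
    the other. *)
Lemma simple_quotient_unique (Z : A) (L L' : K) (p : hom (P Z) L) (p' : hom (P Z) L') :
  H L -> simple_in L -> H L' -> simple_in L' -> S Z -> local_end Z ->
  p <> 0 -> p' <> 0 -> exists u, is_iso u /\ u \c p = p'.
Proof.
move=> HL sL HL' sL' SZ lZ.
have fac (L1 L2 : K) (p1 : hom (P Z) L1) (p2 : hom (P Z) L2) :
    H L1 -> simple_in L1 -> H L2 -> simple_in L2 -> p1 <> 0 -> p2 <> 0 ->
    exists u, u \c p1 = p2.
  move=> HL1 sL1 HL2 sL2 p10 p20; apply: factor_through => //.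
  - exact: heart_orthogonal hH _ HL2.
  - exact: simple_surj.
  move=> N f SN p1f; apply: contrapT => /(simple_split_epi HL2 sL2 SN SZ lZ)[h fh].
  by apply: p10; rewrite -[LHS]compm1 -Pmap1 -fh PmapM compA p1f comp0m.
move=> p0 p'0; have [u up] := fac _ _ _ _ HL sL HL' sL' p0 p'0.
have [v vp'] := fac _ _ _ _ HL' sL' HL sL p'0 p0.
have ep := surj_epi HL (simple_surj HL sL SZ p0).
have ep' := surj_epi HL' (simple_surj HL' sL' SZ p'0).
exists u; split=> //; exists v; split.
- by apply: ep => //; rewrite -compA up vp' comp1m.
- by apply: ep' => //; rewrite -compA vp' up comp1m.
Qed.

Lemma P_projective (M : A) (X Y : K) (e : hom X Y) (f : hom (P M) Y) :
  S M -> H X -> H Y -> epi_in e -> exists g, e \c g = f.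
Proof.
move=> SM HX HY ee; have [g ->] := epi_surj HX HY ee f SM.
by exists g.
Qed.

(** Projectivity splits the generator [x], so [X] is the image of an idempotent of [P M0]. By full
    faithfulness it comes from A, where it splits. *)
Lemma projective_P (X : K) : H X ->
  (forall Y Z (e : hom Y Z) (f : hom X Z), H Y -> H Z -> epi_in e ->
     exists g, e \c g = f) ->
  exists Z, S Z /\ isomorphic (P Z) X.
Proof.
move=> HX pX.
have [M1 [M0 [r [x [_ SM0 [_ xs _ xi _]]]]]] := heart_presents hH HX.
have ex : epi_in x by move=> Z g h /(heart_orthogonal hH)/xi; exact.
have [s xs1] := pX _ _ x (idm X) (heart_P hH SM0) HX ex.
have [e eE] := Pmap_full (s \c x).
have ee : e \c e = e.
  by apply: (Pmap_inj (abA := abA)); rewrite PmapM -eE compA -(compA s) xs1 compm1.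
have [Z [i [p [pi ip]]]] := idempotent_split abA ee.
exists Z; split; first refine (heart_retract hH pi SM0).
exists (x \c Pm i), (Pm p \c s); split.
- rewrite compA -(compA _ s) eE -!PmapM -ip !compA pi comp1m pi.
  exact: Pmap1.
- rewrite compA -(compA x) -PmapM ip -eE compA xs1 comp1m; exact: xs1.
Qed.

End Hearts.

(** * Local endomorphism rings and indecomposability *)

Section LocalObjects.
Variable A : preadditive.

Lemma local_end_iso (X Y : A) : isomorphic X Y -> local_end X -> local_end Y.
Proof.
case=> u [v [vu uv]] [X0 lX].
have iu : is_iso u by exists v.
have iv : is_iso v by exists u.
split=> [Y0|f g fg]; first by apply: X0; rewrite -vu -[u]comp1m Y0 comp0m compm0.
have conj h : is_iso (v \c h \c u) -> is_iso h.
  have {2}-> : h = u \c (v \c h \c u) \c v.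
    by rewrite !compA uv comp1m -compA uv compm1.
  by move=> ih; do 2!apply: is_iso_comp => //.
have : is_iso (v \c f \c u + v \c g \c u).
  by rewrite -compDl -compDr; do 2!apply: is_iso_comp => //.
by case/lX=> /conj; [left | right].
Qed.

(** The two projectors sum to the identity, so one of them is invertible; being orthogonal to it,
    the other summand vanishes. *)
Lemma local_end_biproduct (X Y Z : A) :
  local_end X -> is_biproduct Y Z X -> is_zero Y \/ is_zero Z.
Proof.
move=> [_ lX] [i1 [i2 [p1 [p2 [p1i1 p2i2 p1i2 p2i1 ip]]]]].
have : is_iso (i1 \c p1 + i2 \c p2) by rewrite ip; exists (idm X); rewrite comp1m.
case/lX=> -[g [_ ipg]]; [right|left]; apply/is_zeroP.
  by rewrite -p2i2 -[p2]compm1 -ipg !compA p2i1 !comp0m.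
by rewrite -p1i1 -[p1]compm1 -ipg !compA p1i2 !comp0m.
Qed.

Lemma is_biproduct_iso (X X' Y Z : A) :
  isomorphic X X' -> is_biproduct Y Z X -> is_biproduct Y Z X'.
Proof.
case=> u [v [vu uv]] [i1 [i2 [p1 [p2 [e1 e2 e3 e4 e5]]]]].
exists (u \c i1), (u \c i2), (p1 \c v), (p2 \c v).
split; rewrite !compA -?(compA _ v) ?vu ?compm1 //.
by rewrite -!(compA u) -compDr -compDl e5 comp1m.
Qed.

Lemma local_end_indecomposable (X : A) : local_end X -> indecomposable X.
Proof.
move=> lX; split=> [/is_zeroP|Y Z]; first by case: lX.
exact: local_end_biproduct.
Qed.

(** A Krull-Schmidt decomposition has a local first summand, whose complement must vanish. The
    predicate [S] serves A and its subcategory at once. *)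
Lemma indecomposable_local (abA : abelian_cat A) (S : A -> Prop) (Z : A) :
  krull_schmidt A ->
  (forall M Z (i : hom Z M) (p : hom M Z), p \c i = idm Z -> S M -> S Z) ->
  S Z -> ~ is_zero Z ->
  (forall Y1 Y2, S Y1 -> S Y2 -> is_biproduct Y1 Y2 Z -> is_zero Y1 \/ is_zero Y2) ->
  local_end Z.
Proof.
move=> ksA rS SZ Z0 iZ; have [n [s [ls [i [p [pi _ ip]]]]]] := ksA Z.
case: n => [|n] in s ls i p pi ip *.
  by case: Z0; apply/is_zeroP; rewrite -ip big_ord0.
have [Z' [i' [p' [p'i' pi' p'i ip']]]] := retract_biproduct abA (pi ord0).
have bZ : is_biproduct (s ord0) Z' Z by exists (i ord0), i', (p ord0), p'.
case: (iZ _ _ (rS _ _ _ _ (pi ord0) SZ) (rS _ _ _ _ p'i' SZ) bZ) => [s0|[z _]].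
  by have [+ _] := ls ord0; have /is_zeroP := s0.
apply: (local_end_iso _ (ls ord0)); exists (i ord0), (p ord0); split=> //.
by rewrite -ip' (z _ i') comp0m addr0.
Qed.

End LocalObjects.

(** * The hearts as full subcategories of K^-(A) *)

Section FullSubcategories.
Variables (A : preadditive) (H : A -> Prop).

Lemma full_is_zero (X : full_sub H) : is_zero X <-> is_zero (sval X).
Proof. by rewrite !is_zeroP. Qed.

End FullSubcategories.

Section FullHearts.
Variables (A : preadditive) (H : Kminus A -> Prop).

Lemma epi_inP (X Y : full_sub H) (e : hom X Y) :
  epi e <-> epi_in H (e : @hom (Kminus A) (sval X) (sval Y)).
Proof.
split=> ee Z g h; last exact: ee (svalP Z).
by move=> HZ; exact: (ee (exist _ Z HZ) g h).
Qed.

Lemma mono_inP (X Y : full_sub H) (m : hom X Y) :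
  mono m <-> mono_in H (m : @hom (Kminus A) (sval X) (sval Y)).
Proof.
split=> mm W g h; last exact: mm (svalP W).
by move=> HW; exact: (mm (exist _ W HW) g h).
Qed.

Lemma simple_inP (X : full_sub H) : simple X <-> simple_in H (sval X).
Proof.
split=> -[X0 sX]; split.
- by move=> /full_is_zero.
- move=> Y m HY mm; have [|/full_is_zero|] := sX (exist _ Y HY) m; last by right.
    exact/mono_inP.
  by left.
- by move=> /full_is_zero.
- move=> Y m /mono_inP mm; have [/(full_is_zero Y)|] := sX _ _ (svalP Y) mm.
    by left.
  by right.
Qed.

Lemma simple_quotient_neq0 (X L : full_sub H) (p : hom X L) :
  simple_quotient p -> p <> 0.
Proof.
move=> [[L0 _] ep] p0; apply: L0; apply/is_zeroP; apply: ep.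
by rewrite p0 !compm0.
Qed.

End FullHearts.

Section HeartInstances.
Variables (A : preadditive) (abA : abelian_cat A).
Local Notation K := (Kminus A).

Lemma heartA_like : heart_like abA (fun _ => True) (@heartA_pred A).
Proof.
split=> //.
- move=> X [X0 _].
  have X0' (i : int) : 0 < i -> is_zero (term X i).
    by move=> i0; apply: X0; rewrite i0 orbT.
  have [x px] := @complex_presents A abA (fun _ => True) X I (fun=> I) X0'.
  by exists (term X (-1)), (term X 0), (diff X (-1) 0), x.
- by move=> X hX; exact: heartA_orthogonal.
- by move=> M _; exact: stalk0_heartA.
- move=> W hW; exists W, (idm W); split=> // X _.
  by split=> [g|g h]; [exists g | ]; rewrite !comp1m.
Qed.

Variables (C : A -> Prop) (addC : additive_cat (full_sub C)).
Hypotheses (isoC : strictly_full C) (karC : karoubi_closed C) (appC : approximating C).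

Lemma heartC_T_C (X : K) : heartC_pred C X -> T_C C X.
Proof. by case=> -[]. Qed.

Lemma pi_C_heartC (W : K) : heartA_pred W -> heartC_pred C (pi_C appC W).
Proof.
move=> hW.
by have [] := approximation_heartC abA addC isoC karC hW (projT2 (cid (appC W))).
Qed.

Lemma pi_C_adjunction (W : K) : heartA_pred W ->
  exists t : hom (pi_C appC W) W, forall X, heartC_pred C X ->
    (forall g : hom X W, exists g', g = t \c g') /\
    (forall g g' : hom X (pi_C appC W), t \c g = t \c g' -> g = g').
Proof.
move=> hW; have [_ [t tP]] :=
  approximation_heartC abA addC isoC karC hW (projT2 (cid (appC W))).
by exists t => X /heartC_T_C; exact: tP.
Qed.

Lemma heartC_like : heart_like abA C (heartC_pred C).
Proof.
split.
- exact: heartC_presents.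
- exact: heartC_orthogonal.
- by move=> M CM; exact: (stalk0_heartC abA addC isoC (exist _ M CM)).
- move=> W hW; have [t tP] := pi_C_adjunction hW.
  by exists (pi_C appC W), t; split=> //; exact: pi_C_heartC.
- by move=> M Z i p; exact: karoubi_retract.
Qed.

End HeartInstances.

(** * Simple objects under restriction from H_A to H_C *)

Section SimpleQuotients.
Variables (A : preadditive) (abA : abelian_cat A).
Local Notation K := (Kminus A).
Local Notation P := (stalk0 abA).
Local Notation Pm := (Pmap abA).

Lemma P_local_end (Z : A) : local_end Z -> @local_end K (P Z).
Proof.
move=> [Z0 lZ]; split=> [|f g]; first by rewrite -Pmap1 => /Pmap_eq0.
have [f' ->] := Pmap_full f; have [g' ->] := Pmap_full g.
have isoP h : is_iso h -> @is_iso K _ _ (Pm h).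
  by case=> k [kh hk]; exists (Pm k); rewrite -!PmapM kh hk !Pmap1.
rewrite -PmapD => -[k]; have [k' ->] := Pmap_full k.
rewrite -!PmapM -!Pmap1 => -[/Pmap_inj kf /Pmap_inj fk].
have /lZ[/isoP|/isoP] : is_iso (f' + g') by exists k'.
  by left.
by right.
Qed.

Lemma P_is_zero (M : A) : is_zero M <-> @is_zero K (P M).
Proof.
rewrite !is_zeroP -Pmap1; split=> [->|]; first exact: Pmap0.
exact: Pmap_eq0.
Qed.

Lemma P_biproduct (M N Z : A) :
  is_biproduct M N Z -> @is_biproduct K (P M) (P N) (P Z).
Proof.
case=> [i1 [i2 [p1 [p2 [e1 e2 e3 e4 e5]]]]].
exists (Pm i1), (Pm i2), (Pm p1), (Pm p2).
by split; rewrite -!PmapM -?PmapD ?(e1, e2, e3, e4, e5) ?Pmap1 ?Pmap0.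
Qed.

Variables (C : A -> Prop) (addC : additive_cat (full_sub C)).
Hypotheses (isoC : strictly_full C) (karC : karoubi_closed C) (appC : approximating C).
Let hA := heartA_like abA.
Let hC := heartC_like abA addC isoC karC appC.

Section SimpleA.
Variables (Z : A) (L : K) (p : @hom K (P Z) L).
Hypotheses (lZ : local_end Z) (hL : heartA_pred L).
Hypotheses (sL : simple_in (@heartA_pred A) L) (p0 : p <> 0).

(** The lift p' of [p] is surjective on C. For a nonzero subobject [m] with generator [y], write m y
    = p' f; then p f is nonzero, [f] splits, and p' factors through [m], which is therefore
    surjective. *)
Lemma pi_C_simple : C Z -> simple_in (heartC_pred C) (pi_C appC L) /\
  exists p' : @hom K (P Z) (pi_C appC L), p' <> 0.
Proof.
move=> CZ; have hV := pi_C_heartC abA addC isoC karC appC hL.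
have [t tP] := pi_C_adjunction abA addC isoC karC appC hL.
have tPM M : C M -> _ := fun CM => tP _ (heart_P hC (M := M) CM).
have [p' pE] := (tPM _ CZ).1 p.
have p'0 : p' <> 0 by move=> p'0; apply: p0; rewrite pE p'0 compm0.
split; last by exists p'.
split=> [/is_zeroP V0|Y m hY mm]; first by apply: p'0; rewrite -[p']comp1m V0 comp0m.
have [Y0|nY0] := pselect (is_zero Y); [by left | right].
have [M [y [CM y0 _]]] := nonzero_generator hC hY nY0.
have sp : surj_in abA C p'.
  move=> N h CN; have [k hk] := simple_surj hA hL sL I p0 (t \c h) I.
  by exists k; apply: (tPM _ CN).2; rewrite hk compA -pE.
apply: (mono_surj_iso hC) => // N h CN.
have [z] := sp _ (m \c y) CM; have [f ->] := Pmap_full z => myE.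
have [g fg] : exists g, f \c g = idm Z.
  apply: (simple_split_epi hA hL sL I I lZ (p := p)) => pf; apply: y0.
  apply: mm; first exact: heart_P hC _ CM.
  rewrite compm0 myE; apply: (tPM _ CM).2.
  by rewrite compA -pE pf compm0.
have [k ->] := sp _ h CN; exists (y \c Pm g \c k).
by rewrite !compA myE -(compA p') -PmapM fg Pmap1 compm1.
Qed.

(** A nonzero generator with source [P M], M in C, would give a map p f to [L] that is nonzero; then
    [f] splits and [Z] is a direct summand of [M]. *)
Lemma pi_C_zero : ~ C Z -> is_zero (pi_C appC L).
Proof.
move=> nCZ; have hV := pi_C_heartC abA addC isoC karC appC hL.
have [t tP] := pi_C_adjunction abA addC isoC karC appC hL.
apply: contrapT => nV0; have [M [y [CM y0 _]]] := nonzero_generator hC hV nV0.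
apply: y0; apply: (tP _ (heart_P hC CM)).2; rewrite compm0.
have [z zE] := simple_surj hA hL sL I p0 (t \c y) I; rewrite zE.
have [f fE] := Pmap_full z; rewrite fE; apply: contrapT => pf.
have [g fg] := simple_split_epi hA hL sL I I lZ pf.
by apply: nCZ; exact: heart_retract hC _ _ _ _ fg CM.
Qed.

End SimpleA.

Lemma indecomposable_local_C (Z : full_sub C) :
  krull_schmidt A -> indecomposable Z -> local_end (sval Z).
Proof.
move=> ksA [Z0 iZ]; apply: (indecomposable_local abA ksA (heart_retract hC) (svalP Z)).
  by move=> /(full_is_zero Z).
move=> Y1 Y2 C1 C2 b.
by have [/full_is_zero|/full_is_zero] := iZ (exist _ Y1 C1) (exist _ Y2 C2) b; [left|right].
Qed.

Lemma indecomposable_local_A (Z : A) :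
  krull_schmidt A -> indecomposable Z -> local_end Z.
Proof.
move=> ksA [Z0 iZ]; apply: (indecomposable_local abA (S := fun _ => True)) => //.
by move=> Y1 Y2 _ _; exact: iZ.
Qed.

End SimpleQuotients.

Theorem corollary3p21
  (A : preadditive) (abA : abelian_cat A)
  (C : A -> Prop) (addC : additive_cat (full_sub C))
  (isoC : strictly_full C) (karC : karoubi_closed C)
  (appC : approximating C)
  (ksA : krull_schmidt A) (esA : enough_simples (heartA A)) :
  enough_simples (heartC C) /\
  exists L : full_sub C -> heartC C,
    (forall Z : full_sub C, indecomposable Z ->
       unique_simple_quotient (P_C abA addC isoC Z) (L Z)) /\
    (forall Z : A, indecomposable Z ->
       exists LA : heartA A,
         unique_simple_quotient (P_A abA Z) LA /\
         (forall CZ : C Z,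
            isomorphic (pi_C appC (proj1_sig LA))
                       (proj1_sig (L (exist _ Z CZ)))) /\
         (~ C Z -> is_zero (pi_C appC (proj1_sig LA)))) /\
    (forall S : heartC C, simple S ->
       exists M : full_sub C, indecomposable M /\ isomorphic S (L M)).
Proof.
pose hA := heartA_like abA; pose hC := heartC_like abA addC isoC karC appC.
have exLA (Z : A) : exists L : heartA A, local_end Z ->
    exists p : hom (P_A abA Z) L, simple_quotient p.
  (* Without a local endomorphism ring the value is a dummy; it only makes the choice function
     total. *)
  have [lZ|nlZ] := pselect (local_end Z); last by exists (P_A abA Z).
  have [|L pL] := esA (P_A abA Z) _
    (@local_end_indecomposable (heartA A) (P_A abA Z) (P_local_end abA lZ)).
    move=> X Y e f /epi_inP ee.
    exact: (P_projective hA f I (svalP X) (svalP Y) ee).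
  by exists L.
have [LA LAP] := choice exLA.
(* Taking the image under pi_C as definition of [L] makes the comparison for Z in C a
   reflexivity. *)
pose L (Z : full_sub C) : heartC C :=
  exist _ (pi_C appC (sval (LA (sval Z))))
    (pi_C_heartC abA addC isoC karC appC (svalP (LA (sval Z)))).
have LP (Z : full_sub C) : local_end (sval Z) ->
    simple (L Z) /\ exists p : hom (P_C abA addC isoC Z) (L Z), p <> 0.
  move=> lZ; have [p pq] := LAP _ lZ; rewrite simple_inP.
  apply: (pi_C_simple addC isoC karC appC lZ (svalP (LA (sval Z))) _
            (simple_quotient_neq0 pq) (svalP Z)).
  by apply/simple_inP; case: pq.
have quot_C (Z : full_sub C) (X : heartC C) (p : hom (P_C abA addC isoC Z) X) :
    simple X -> p <> 0 -> simple_quotient p.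
  move=> sX p0; split=> //; apply/epi_inP/(surj_epi hC (svalP X)).
  by apply: (simple_surj hC (svalP X) _ (svalP Z) p0); apply/simple_inP.
have LQ (Z : full_sub C) : local_end (sval Z) ->
    unique_simple_quotient (P_C abA addC isoC Z) (L Z).
  move=> lZ; have [sL [p p0]] := LP Z lZ; exists p; split; first exact: quot_C.
  move=> L' p' q'; have [sL' _] := q'.
  apply: (simple_quotient_unique hC (svalP (L Z)) _ (svalP L') _ (svalP Z) lZ p0
            (simple_quotient_neq0 q')); exact/simple_inP.
split.
  move=> X pX iX.
  (* An indecomposable projective of H_C is isomorphic to some [P Z], so it inherits the simple
     quotient found there. *)
  have [Y Z e f HY HZ ee|Z [CZ uX]] := projective_P hC (svalP X).
    by apply: (pX (exist _ Y HY) (exist _ Z HZ)); exact/epi_inP.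
  pose ZC : full_sub C := exist _ Z CZ.
  have lZ : local_end Z.
    apply: (indecomposable_local_C abA addC isoC karC appC (Z := ZC) ksA).
    split=> [Z0|Y1 Y2 bZ].
      apply: iX.1; apply/full_is_zero; apply: (is_zero_iso uX).
      exact: ((P_is_zero abA Z).1 ((full_is_zero ZC).1 Z0)).
    have bX := is_biproduct_iso uX (P_biproduct abA bZ).
    have PC0 (Y : full_sub C) : is_zero (P_C abA addC isoC Y) -> is_zero Y.
      move=> /full_is_zero PY; apply/full_is_zero; exact: ((P_is_zero abA _).2 PY).
    by case: (iX.2 (P_C abA addC isoC Y1) (P_C abA addC isoC Y2) bX) => /PC0; [left|right].
  have [p [[sL ep] _]] := LQ ZC lZ.
  have [u [v [vu _]]] : @isomorphic (heartC C) (P_C abA addC isoC ZC) X := uX.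
  exists (L ZC), (p \c v); split=> // Y g h gh; apply: ep.
  by rewrite -[g \c p]compm1 -[h \c p]compm1 -vu !compA -!(compA _ p) gh.
exists L; split; [|split].
- by move=> Z iZ; apply: LQ; exact: indecomposable_local_C iZ.
- move=> Z iZ; have lZ := indecomposable_local_A abA ksA iZ.
  have [p pq] := LAP _ lZ; exists (LA Z); split; [|split].
  + exists p; split=> // L' p' q'; have [sL' _] := q'; have [sL _] := pq.
    apply: (simple_quotient_unique hA (svalP (LA Z)) _ (svalP L') _ I lZ
      (simple_quotient_neq0 pq) (simple_quotient_neq0 q')); exact/simple_inP.
  + by move=> CZ; exact: isomorphic_refl.
  + apply: (pi_C_zero addC isoC karC appC lZ (svalP (LA Z)) _ (simple_quotient_neq0 pq)).
    by apply/simple_inP; case: pq.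
- move=> X sX; have [X0 _] := (simple_inP X).1 sX.
  have [M [y [CM y0 _]]] := nonzero_generator hC (svalP X) X0.
  (* The generator [y] is nonzero on some local summand of [M]. That summand lies in C, and
     uniqueness of its simple quotient identifies [X]. *)
  have [n [s [ls [i [p [pi _ ip]]]]]] := ksA M.
  have [k yk] : exists k, y \c Pmap abA (i k) <> 0.
    apply: contrapT => yi; apply: y0; rewrite -[y]compm1 -Pmap1 -ip.
    elim/big_ind: _ => [|f g yf yg|k _]; first by rewrite Pmap0 compm0.
      by rewrite PmapD compDr yf yg addr0.
    rewrite PmapM compA; apply: contrapT => yk; apply: yi; exists k => yik.
    by apply: yk; rewrite yik comp0m.
  pose N : full_sub C := exist _ (s k) (heart_retract hC (pi k) CM).
  exists N; split.
    exact: (@local_end_indecomposable (full_sub C) N (ls k)).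
  have [q [_ qU]] := LQ N (ls k).
  have [u [iu _]] := qU X _ (quot_C N X _ sX yk).
  by apply: isomorphic_sym; exists u.
Qed.
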